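(* Let $\mu$ be a probability measure on $\mathbf Q=[0,1]^2$ possessing a strictly positive density $p\in C^1(\mathbf Q)$ with respect to Lebesgue measure, and let $\{Z_i\}_{i=1}^n=\{(X_i,Y_i)\}_{i=1}^n$ be i.i.d. with law $\mu$. Let $c<0$. Then $$\limsup_{n\to\infty}\frac1n\log P\big(\ell_{\max}(n)\le(2\bar J_\mu+c)\sqrt n\big)<0 .$$
   Context: A subsequence $\{Z_{i_1},\dots,Z_{i_\ell}\}$ of the sample is called (monotone) increasing of length $\ell$ if $X_{i_j}<X_{i_{j+1}}$ and $Y_{i_j}<Y_{i_{j+1}}$ for $j=1,\dots,\ell-1$ (it is not required that $i_j<i_{j+1}$); $\ell_{\max}(n)$ is the length of the longest increasing subsequence of $\{Z_i\}_{i=1}^n$. $B^\uparrow$ is the set of non-decreasing, absolutely continuous functions $\phi:[0,1]\to[0,1]$, and $$\bar J_\mu=\sup_{\phi\in B^\uparrow}\int_0^1\sqrt{p(x,\phi(x))\,\dot\phi(x)}\,dx .$$ Convention: $\log 0=-\infty$. *)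

(* Defs.v *)
From HB Require Import structures.
From mathcomp Require Export all_boot all_order all_algebra finmap.
From mathcomp Require Export all_classical all_reals all_analysis.
Export numFieldNormedType.Exports.

Set Implicit Arguments.
Unset Strict Implicit.
Unset Printing Implicit Defensive.

Import Order.TTheory GRing.Theory Num.Theory.
Local Open Scope classical_set_scope.
Local Open Scope ring_scope.

(* The plane, with the Borel product sigma-algebra. *)
Notation plane R := (measurableTypeR R * measurableTypeR R)%type.

Definition unit_square (R : realType) : set (R * R) :=
  `[0, 1]%classic `*` `[0, 1]%classic.

(* p is C^1 on the closed square: p is continuous on the square, and its partial
   derivatives exist in the interior and extend continuously to the boundary.
   The values of p off the square are irrelevant. *)
Definition C1_on_unit_square (R : realType) (p : R * R -> R) : Prop :=
  exists px py : R * R -> R,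
    [/\ {within @unit_square R, continuous p},
        {within @unit_square R, continuous px},
        {within @unit_square R, continuous py} &
        forall x y : R, 0 < x < 1 -> 0 < y < 1 ->
          is_derive x 1 (fun t : R => p (t, y)) (px (x, y)) /\
          is_derive y 1 (fun t : R => p (x, t)) (py (x, y))].

Definition has_density_on_unit_square (R : realType)
    (mu : probability (plane R) R) (p : R * R -> R) : Prop :=
  forall A : set (plane R), measurable A ->
    mu A = (\int[(@lebesgue_measure R) \x (@lebesgue_measure R)]_(z in A `&` @unit_square R)
              (p z)%:E)%E.

Definition mutually_independent d d' (T : measurableType d)
    (T' : measurableType d') (R : realType) (P : probability T R)
    (X : nat -> {RV P >-> T'}) : Prop :=
  forall (J : {fset nat}) (A : nat -> set T'), (forall i, measurable (A i)) ->
    P (\bigcap_(i in [set` J]) (X i @^-1` A i)) =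
    (\prod_(i <- J) P (X i @^-1` A i))%E.

Definition iid_with_law d d' (T : measurableType d) (T' : measurableType d')
    (R : realType) (P : probability T R) (X : nat -> {RV P >-> T'})
    (mu : probability T' R) : Prop :=
  mutually_independent X /\
  forall i (A : set T'), measurable A -> distribution P (X i) A = mu A.

(* The sample of size n is z 0, ..., z n.-1.  The indices listed in the tuple t
   need not be increasing; they are automatically distinct, so the bound l <= n
   is no restriction. *)
Definition longest_increasing (R : realType) (n : nat) (z : nat -> R * R) : nat :=
  \max_(l < n.+1 | [exists t : l.-tuple 'I_n,
      sorted [rel i j : 'I_n | ((z i).1 < (z j).1) && ((z i).2 < (z j).2)] t])
    (l : nat).

Definition absolutely_continuous_on (R : realType) (a b : R) (f : R -> R) : Prop :=
  forall e : R, 0 < e -> exists2 delta : R, 0 < delta &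
    forall (n : nat) (u v : nat -> R),
      (forall i, (i < n)%N -> a <= u i /\ u i <= v i /\ v i <= b) ->
      trivIset `I_n (fun i => `]u i, v i[%classic) ->
      \sum_(i < n) (v i - u i) < delta ->
      \sum_(i < n) `|f (v i) - f (u i)| < e.

(* Functions [0,1] -> [0,1] are represented by functions R -> R whose values
   off [0,1] are irrelevant. *)
Definition Bup (R : realType) : set (R -> R) :=
  [set phi | [/\ {in `[0, 1] &, {homo phi : x y / x <= y}},
                 absolutely_continuous_on 0 1 phi &
                 forall x, x \in `[0, 1] -> phi x \in `[0, 1] ]].

(* derive1 phi x is an arbitrary real where phi is not derivable, which happens only
   on a Lebesgue-null set for phi in Bup. *)
Definition Jbar (R : realType) (p : R * R -> R) : \bar R :=
  ereal_sup [set (\int[@lebesgue_measure R]_(x in `[0%R, 1%R])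
                    (Num.sqrt (p (x, phi x) * derive1 phi x))%:E)%E | phi in @Bup R].

(* Main.v *)
From HB Require Import structures.
Require Import Defs.
From mathcomp Require Import measurable_realfun lra zify.

(** Three ideas show that the chance that no increasing chain is longer than
    (2 Jbar + c) sqrt n is exponentially small in n.

    The constant 2 comes from a lattice model.  Let every cell of an n x n square be
    occupied independently with probability q, and let lis be the length of the longest
    chain of occupied cells that increases strictly in both coordinates.  Put extra
    points on the lower side (sources, density a) and on the left side (sinks, density
    b), a path being allowed to start along one of these two sides.  If
    a b = q (1 - a) (1 - b), the increments of the last-passage values along each row are
    again independent coins of density a (Burke_profile), so the value of the whole
    square is a sum of sinks plus a sum of coins and is close to (a + b) n.  Compare, on
    the same field, the symmetric system a = b = a0 with two slightly tilted ones.  A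
    path that collects boundary points over a distance e n or more would be too long for
    one of the tilted systems, so the optimal path of the symmetric system leaves the
    boundary early and lis is at least (2 - e) a0 n up to fluctuations
    (lis_ge_stationary, expect_lis).  With q = r^2 one has a0 = r / (1 + r), and as r
    tends to 0 this is 2 per square root of the mean number of points.

    The speed n comes from parallel paths.  A rectangle is cut into blocks of a fixed
    number of cells, of order n blocks in total, and a chain may follow any of the
    diagonals of blocks next to the main one.  If all chains are short, then a sum of
    order n block lengths is below its mean by a fixed proportion
    (some_diagonal_chain), and Chernoff's bound applies once the blocks are
    independent.  They become exactly independent when the sample size is a Poisson
    variable (Poissonization); its mean is taken slightly below n, and since the
    bad event is decreasing in the sample size this costs a constant factor
    (depoissonization).  The result is rectangle_tail: where the density is at least m,
    chains of length (2 - 12 e) sqrt (m area n) exist up to probability exp (- k n).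

    The functional is recovered by gluing rectangles.  Along a nearly optimal phi the
    unit interval is cut into short pieces; on each piece the inequality of arithmetic
    and geometric means bounds the integral of sqrt (p phi') by sqrt (m area) of the box
    spanned by the piece, where m is nearly the density there (path_integral_boxes).
    This uses that phi' exists almost everywhere and integrates to at most the increment
    of phi (ac_density).  Chains in successive boxes concatenate, and there are finitely
    many boxes, so a union bound concludes. *)

Set Implicit Arguments.
Unset Strict Implicit.
Unset Printing Implicit Defensive.

Import Order.TTheory GRing.Theory Num.Theory.
Local Open Scope classical_set_scope.
Local Open Scope ring_scope.

(** * Finite laws *)

Section FiniteLaws.
Context {R : realType}.

(** A finite law is a list of weighted outcomes; being a finite sum, its expectation
    commutes with any other one, which is all the probability the lattice model needs. *)
Definition expect A (d : seq (R * A)) (f : A -> R) : R := \sum_(x <- d) x.1 * f x.2.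

(** The predicate [Q] holds on the support; it carries the sizes of the random lists. *)
Definition law_on A (Q : pred A) (d : seq (R * A)) : Prop :=
  all (fun x => (0 <= x.1) && Q x.2) d /\ expect d (fun=> 1) = 1.

Definition coin (a : R) : seq (R * bool) := [:: (a, true); (1 - a, false)].

Fixpoint iid A (d : seq (R * A)) (n : nat) : seq (R * seq A) :=
  if n is m.+1 then [seq (x.1 * y.1, x.2 :: y.2) | x <- d, y <- iid d m]
  else [:: (1, [::])].

Lemma eq_expect A (d : seq (R * A)) f g : f =1 g -> expect d f = expect d g.
Proof. by move=> fg; apply: eq_bigr => x _; rewrite fg. Qed.

Lemma expect_coin a f : expect (coin a) f = a * f true + (1 - a) * f false.
Proof. by rewrite /expect !big_cons big_nil addr0. Qed.

Lemma expect_iid0 A (d : seq (R * A)) f : expect (iid d 0) f = f [::].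
Proof. by rewrite /expect big_seq1 mul1r. Qed.

Lemma expect_iidS A (d : seq (R * A)) n f :
  expect (iid d n.+1) f = expect d (fun x => expect (iid d n) (fun s => f (x :: s))).
Proof.
rewrite /expect /= big_allpairs_dep; apply: eq_bigr => x _.
by rewrite mulr_sumr; apply: eq_bigr => y _; rewrite mulrA.
Qed.

Lemma expect_swap A B (d : seq (R * A)) (e : seq (R * B)) (f : A -> B -> R) :
  expect d (fun x => expect e (f x)) = expect e (fun y => expect d (f^~ y)).
Proof.
rewrite /expect; under eq_bigr do rewrite mulr_sumr.
rewrite exchange_big; apply: eq_bigr => y _; rewrite mulr_sumr.
by apply: eq_bigr => x _; rewrite mulrCA.
Qed.

Lemma expectD A (d : seq (R * A)) f g : expect d (fun x => f x + g x) = expect d f + expect d g.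
Proof. by rewrite -big_split; apply: eq_bigr => x _; rewrite mulrDr. Qed.

Lemma expectZ A (d : seq (R * A)) c f : expect d (fun x => c * f x) = c * expect d f.
Proof. by rewrite /expect mulr_sumr; apply: eq_bigr => x _; rewrite mulrCA. Qed.

Lemma expectZr A (d : seq (R * A)) c f : expect d (fun x => f x * c) = expect d f * c.
Proof. by rewrite /expect mulr_suml; apply: eq_bigr => x _; rewrite mulrA. Qed.

Lemma expect_sum A I (r : seq I) (d : seq (R * A)) (F : I -> A -> R) :
  expect d (fun x => \sum_(i <- r) F i x) = \sum_(i <- r) expect d (F i).
Proof.
rewrite /expect; under eq_bigr do rewrite mulr_sumr.
by rewrite exchange_big.
Qed.

Lemma expect_cst A Q (d : seq (R * A)) c : law_on Q d -> expect d (fun=> c) = c.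
Proof.
case=> _ d1; rewrite -[RHS]mulr1 -d1 -expectZ.
by apply: eq_expect => x; rewrite mulr1.
Qed.

Lemma le_expect A Q (d : seq (R * A)) f g : law_on Q d ->
  (forall x, Q x -> f x <= g x) -> expect d f <= expect d g.
Proof.
case=> + _ fg; rewrite /expect; elim: d => [|x d IH] /=; first by rewrite !big_nil.
move=> /andP[/andP[x0 Qx] /IH h]; rewrite !big_cons.
by rewrite lerD// ler_wpM2l// fg.
Qed.

Lemma eq_expect_on A Q (d : seq (R * A)) f g : law_on Q d ->
  (forall x, Q x -> f x = g x) -> expect d f = expect d g.
Proof.
by move=> dQ fg; apply/eqP; rewrite eq_le !(le_expect dQ)// => x Qx; rewrite fg.
Qed.

Lemma expect_ge0 A Q (d : seq (R * A)) f : law_on Q d ->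
  (forall x, Q x -> 0 <= f x) -> 0 <= expect d f.
Proof. by move=> dQ f0; rewrite -(expect_cst 0 dQ); exact: (le_expect dQ). Qed.

Lemma law_coin a : 0 <= a <= 1 -> law_on predT (coin a).
Proof.
move=> /andP[a0 a1]; split; first by rewrite /= a0 subr_ge0 a1.
by rewrite expect_coin !mulr1 addrC subrK.
Qed.

Lemma law_iid A Q (d : seq (R * A)) n : law_on Q d ->
  law_on (fun s => (size s == n) && all Q s) (iid d n).
Proof.
move=> dQ; elim: n => [|n [IH IH1]].
  by split; [rewrite /= ler01|rewrite expect_iid0].
split; last first.
  by rewrite expect_iidS -[RHS](expect_cst 1 dQ); apply: eq_expect => x.
case: dQ => dQ _; rewrite /=; elim: d dQ (iid d n) IH {IH1} => //= x d IHd.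
move=> /andP[/andP[x0 Qx] dQ] e eQ; rewrite all_cat IHd// andbT all_map.
apply: sub_all eQ => y /= /andP[y0 /andP[/eqP <- ->]].
by rewrite mulr_ge0// Qx eqxx.
Qed.

Lemma expect_iid_cat A (d : seq (R * A)) m n f :
  expect (iid d (m + n)) f =
  expect (iid d m) (fun s => expect (iid d n) (fun t => f (s ++ t))).
Proof.
elim: m f => [|m IH] f; first by rewrite expect_iid0.
by rewrite addSn !expect_iidS; apply: eq_expect => x; rewrite IH.
Qed.

End FiniteLaws.

(** * The lattice model with sources and sinks, and its stationarity *)

(** One row of the model in terms of increments of last-passage values.  Across a cell
    with increment [x] below, [J] on the left and occupation [y], the value at the
    upper right corner exceeds the one at the lower left by the maximum of the three, so
    the increments above and on the right are that maximum minus [J] and minus [x]. *)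
Fixpoint row_step (J : bool) (I w : seq bool) : seq bool :=
  match I, w with
  | x :: I', y :: w' =>
      let m := [|| x, J | y] in (m && ~~ J) :: row_step (m && ~~ x) I' w'
  | _, _ => [::]
  end.

(** Increments along the top side, the rows being listed from the top. *)
Fixpoint profile (I bs : seq bool) (ws : seq (seq bool)) : seq bool :=
  match bs, ws with
  | b :: bs', w :: ws' => row_step b (profile I bs' ws') w
  | _, _ => I
  end.

Section Burke.
Context {R : realType}.
Variables a b q : R.
Hypothesis abq : a * b = q * (1 - a) * (1 - b).

(** The relation between a, b and q makes the outgoing pair of increments have the law
    of the incoming one: both pairs (1, 1) and (0, 0) arise with their original weights,
    since an occupied empty corner (weight q (1-a) (1-b)) replaces a crossing (weight
    a b), and the two mixed pairs are left unchanged. *)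
Lemma Burke_vertex (h : bool -> bool -> R) :
  expect (coin b) (fun J => expect (coin a) (fun x => expect (coin q) (fun y =>
    h ([|| x, J | y] && ~~ J) ([|| x, J | y] && ~~ x)))) =
  expect (coin b) (fun J => expect (coin a) (fun x => h x J)).
Proof.
rewrite !expect_coin /=.
set ht := h true true; set hf := h false false.
set h1 := h true false; set h2 := h false true.
have e1 : q * (1 - a) * (1 - b) * ht = a * b * ht by rewrite abq.
have e2 : q * (1 - a) * (1 - b) * hf = a * b * hf by rewrite abq.
lra.
Qed.

(** Induction from left to right: after a cell, the increment handed to the next cell is
    independent of the increments that remain, by [Burke_vertex]. *)
Lemma Burke_row n (f : seq bool -> R) :
  expect (coin b) (fun J => expect (iid (coin a) n) (fun I => expect (iid (coin q) n) (fun w =>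
    f (row_step J I w)))) = expect (iid (coin a) n) f.
Proof.
elim: n f => [|n IH] f.
  by rewrite expect_coin !expect_iid0 /=; lra.
pose h i j := expect (iid (coin a) n) (fun I => expect (iid (coin q) n) (fun w =>
  f (i :: row_step j I w))).
transitivity (expect (coin b) (fun J => expect (coin a) (fun x => h x J))).
  rewrite -Burke_vertex; apply: eq_expect => J; rewrite expect_iidS.
  apply: eq_expect => x; rewrite expect_swap expect_iidS; apply: eq_expect => y.
  by rewrite expect_swap.
rewrite expect_swap expect_iidS; apply: eq_expect => x.
exact: (IH (fun s => f (x :: s))).
Qed.

Lemma Burke_profile n m (f : seq bool -> R) :
  expect (iid (coin a) n) (fun I => expect (iid (coin b) m) (fun bs =>
    expect (iid (iid (coin q) n) m) (fun ws => f (profile I bs ws)))) =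
  expect (iid (coin a) n) f.
Proof.
elim: m f => [|m IH] f.
  by apply: eq_expect => I; rewrite !expect_iid0.
rewrite -[RHS]Burke_row.
transitivity (expect (coin b) (fun J => expect (iid (coin q) n) (fun w =>
  expect (iid (coin a) n) (fun I => expect (iid (coin b) m) (fun bs =>
    expect (iid (iid (coin q) n) m) (fun ws => f (row_step J (profile I bs ws) w))))))).
  transitivity (expect (iid (coin a) n) (fun I => expect (coin b) (fun J =>
    expect (iid (coin q) n) (fun w => expect (iid (coin b) m) (fun bs =>
      expect (iid (iid (coin q) n) m) (fun ws => f (row_step J (profile I bs ws) w))))))).
    apply: eq_expect => I; rewrite expect_iidS; apply: eq_expect => J.
    rewrite [RHS]expect_swap; apply: eq_expect => bs.
    by rewrite expect_iidS.
  rewrite expect_swap; apply: eq_expect => J.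
  by rewrite expect_swap.
apply: eq_expect => J.
rewrite [RHS]expect_swap; apply: eq_expect => w.
exact: (IH (fun I => f (row_step J I w))).
Qed.

End Burke.

(** * Last-passage values *)

Section LastPassage.
Local Open Scope nat_scope.

Fixpoint row_values (g : nat -> nat) (b : nat) (w : seq bool) (i : nat) : nat :=
  if i is j.+1 then
    maxn (maxn (row_values g b w j) (g j.+1)) (g j + nth false w j)
  else b.

(** The last-passage value at column [i] on the top side, with sources [I] on the lower side
    and sinks [bs] on the left side. *)
Fixpoint lpp (I bs : seq bool) (ws : seq (seq bool)) : nat -> nat :=
  match bs, ws with
  | b :: bs', w :: ws' =>
      let g := lpp I bs' ws' in row_values g (g 0 + b) w
  | _, _ => fun i => count id (take i I)
  end.

Definition lis ws i := lpp [::] (nseq (size ws) false) ws i.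

Lemma row_valuesS g b x w i : row_values g b (x :: w) i.+1 =
  row_values (g \o S) (row_values g b (x :: w) 1) w i.
Proof. by elim: i => //= i ->. Qed.

(** The bridge between values and increments: [row_step] is the discrete derivative of
    [row_values]. *)
Lemma row_values_step (c : nat) (J : bool) (I w : seq bool) (g : nat -> nat) i :
  (forall j, j <= size I -> g j = c + count id (take j I)) ->
  size w = size I -> i <= size I ->
  row_values g (c + J) w i = c + J + count id (take i (row_step J I w)).
Proof.
elim: I w c J g i => [|x I IH] [|y w] c J g i gE //= sw.
  by rewrite leqn0 => /eqP -> /=; rewrite addn0.
case: i => [|i] iI; first by rewrite take0 addn0.
rewrite row_valuesS.
have g0 : g 0 = c by rewrite gE// take0 addn0.
have g1 : g 1 = c + x by rewrite gE//= take0 addn0.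
have -> : row_values g (c + J) (y :: w) 1 = c + x + ([|| x, J | y] && ~~ x).
  by rewrite /= g0 g1; case: (x) (J) (y) => [] [] []; rewrite /= ; lia.
rewrite IH//=; last 2 first.
- by move=> j jI; rewrite gE//= addnA.
- by case: sw.
by case: (x) (J) (y) => [] [] []; rewrite /=; lia.
Qed.

Lemma size_step J I w : size w = size I -> size (row_step J I w) = size I.
Proof. by elim: I J w => [|x I IH] J [|y w] //= [/IH ->]. Qed.

Lemma size_profile I bs ws : all (fun w => size w == size I) ws ->
  size (profile I bs ws) = size I.
Proof.
elim: bs ws => [|b bs IH] [|w ws] //= /andP[/eqP sw /IH h].
by rewrite size_step// h.
Qed.

Lemma lpp_profile I bs ws i : size bs = size ws ->
  all (fun w => size w == size I) ws -> i <= size I ->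
  lpp I bs ws i = count id bs + count id (take i (profile I bs ws)).
Proof.
elim: bs ws i => [|b bs IH] [|w ws] i //= [sb] /andP[/eqP sw sws] iI.
have sp := size_profile bs sws.
rewrite [lpp I bs ws 0]IH// take0 addn0.
rewrite (@row_values_step (count id bs) b (profile I bs ws)); last 3 first.
- by move=> j jI; rewrite IH// -sp.
- by rewrite sw sp.
- by rewrite sp.
by rewrite [b + _]addnC.
Qed.

Lemma lpp_leS I bs ws i : lpp I bs ws i <= lpp I bs ws i.+1.
Proof.
case: bs ws => [|b bs] [|w ws] /=; try by elim: i I => [|i IH] [|x I] //=; rewrite ?take0 // leq_add2l.
by rewrite -maxnA leq_maxl.
Qed.

Lemma lpp_homo I bs ws : {homo lpp I bs ws : i j / i <= j}.
Proof. by apply: homo_leq => //; [exact: leq_trans|exact: lpp_leS]. Qed.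

Lemma lpp_le_row I b bs w ws i : lpp I bs ws i <= lpp I (b :: bs) (w :: ws) i.
Proof.
case: i => [|i] /=; first exact: leq_addr.
by rewrite -maxnA maxnCA leq_max leqnn.
Qed.

Lemma lpp0 I bs ws : size bs = size ws -> lpp I bs ws 0 = count id bs.
Proof.
elim: bs ws => [|b bs IH] [|w ws] //=; rewrite ?take0// => -[/IH ->].
by rewrite addnC.
Qed.

Lemma lisS w ws i : lis (w :: ws) i.+1 =
  maxn (maxn (lis (w :: ws) i) (lis ws i.+1)) (lis ws i + nth false w i).
Proof. by []. Qed.

Lemma lis0 ws : lis ws 0 = 0.
Proof. by rewrite /lis lpp0 ?size_nseq// count_nseq mul0n. Qed.

Lemma lis_nil i : lis [::] i = 0. Proof. by []. Qed.

Lemma lis_homo ws : {homo lis ws : i j / i <= j}.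
Proof. exact: lpp_homo. Qed.

Lemma lis_le_row w ws i : lis ws i <= lis (w :: ws) i.
Proof. exact: lpp_le_row. Qed.

(** An optimal path follows one of the two sides and then leaves it for good at some
    distance [k]; afterwards it only sees the field, so the rest is a [lis] of a
    smaller rectangle.  As rows are listed from the top, leaving the left side is
    described by the rows [take k ws] that remain. *)
Lemma lpp_exit I bs ws i : size bs = size ws ->
  (exists2 k, k <= i &
    lpp I bs ws i <= count id (take k I) + lis (map (drop k) ws) (i - k)) \/
  (exists2 k, k <= size ws &
    lpp I bs ws i <= count id (drop k bs) + lis (take k ws) i).
Proof.
elim: bs ws i => [|b bs IHr] [|w ws] i //=; first by left; exists i => //=; rewrite leq_addr.
move=> [sb]; elim: i => [|i IH].
  right; exists 0 => //=.
  by rewrite lpp0// lis_nil addn0 addnC.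
rewrite [lpp _ _ _ _]/=.
have {}IH : let v := row_values (lpp I bs ws) (lpp I bs ws 0 + b) w i in
  (exists2 k, k <= i.+1 & v <= count id (take k I) + lis (map (drop k) (w :: ws)) (i.+1 - k)) \/
  (exists2 k, k <= size (w :: ws) & v <= count id (drop k (b :: bs)) + lis (take k (w :: ws)) i.+1).
  case: IH => -[k ki h]; [left|right]; exists k => //; first exact: leqW.
    by apply: leq_trans h _; rewrite leq_add2l lis_homo// leq_sub2r.
  by apply: leq_trans h _; rewrite leq_add2l lis_homo.
have {}IHu : let v := lpp I bs ws i.+1 in
  (exists2 k, k <= i.+1 & v <= count id (take k I) + lis (map (drop k) (w :: ws)) (i.+1 - k)) \/
  (exists2 k, k <= size (w :: ws) & v <= count id (drop k (b :: bs)) + lis (take k (w :: ws)) i.+1).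
  case: (IHr ws i.+1 sb) => -[k ki h]; [left; exists k|right; exists k.+1] => //.
    by apply: leq_trans h _; rewrite leq_add2l lis_le_row.
  by apply: leq_trans h _; rewrite leq_add2l lis_le_row.
have IHd : let v := lpp I bs ws i + nth false w i in
  (exists2 k, k <= i.+1 & v <= count id (take k I) + lis (map (drop k) (w :: ws)) (i.+1 - k)) \/
  (exists2 k, k <= size (w :: ws) & v <= count id (drop k (b :: bs)) + lis (take k (w :: ws)) i.+1).
  case: (IHr ws i sb) => -[k ki h]; [left; exists k|right; exists k.+1] => //.
  - exact: leqW.
  - rewrite subSn//= lisS nth_drop subnKC//.
    apply: (leq_trans (leq_add h (leqnn _))); rewrite -addnA leq_add2l.
    by rewrite leq_max leqnn orbT.
  - rewrite /= lisS; apply: (leq_trans (leq_add h (leqnn _))).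
    by rewrite -addnA leq_add2l leq_max leqnn orbT.
move: IH IHu IHd => /=.
rewrite /maxn; case: ifP => _ IH IHu IHd; first exact: IHd.
by case: ifP => _; [exact: IHu|exact: IH].
Qed.

Lemma lpp_ge_source I bs ws k i : size bs = size ws ->
  count id (take k I) + lis (map (drop k) ws) i <= lpp I bs ws (k + i).
Proof.
elim: bs ws i => [|b bs IHr] [|w ws] i //=.
  by rewrite lis_nil addn0; have := @lpp_homo I [::] [::] k (k + i) (leq_addr _ _).
move=> [sb]; elim: i => [|i IH].
  rewrite addn0 lis0 addn0.
  have := IHr ws 0 sb; rewrite lis0 !addn0 => /leq_trans; apply.
  exact: (lpp_le_row I b bs w ws).
rewrite lisS addnS /= nth_drop.
have h2 := IHr ws i.+1 sb; rewrite addnS in h2.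
have h3 := IHr ws i sb.
move: IH h2 h3 => /=.
rewrite !addn_maxr !geq_max => h1 h2 h3.
rewrite !leq_max h1 h2 /= addnA.
by rewrite leq_add2r h3 !orbT.
Qed.

Lemma lpp_ge_sink I bs ws k i : size bs = size ws ->
  count id (drop k bs) + lis (take k ws) i <= lpp I bs ws i.
Proof.
elim: k bs ws i => [|k IHk] [|b bs] [|w ws] i //=; try by move=> *; rewrite ?take0 lis_nil.
  move=> sb; rewrite lis_nil addn0.
  by have := @lpp0 I (b :: bs) (w :: ws) sb; rewrite /= => <-; exact: (@lpp_homo I (b :: bs) (w :: ws) 0 i).
move=> [sb]; elim: i => [|i IH].
  rewrite lis0 addn0; have := IHk bs ws 0 sb.
  by rewrite lis0 addn0 => /leq_trans; apply; rewrite leq_addr.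
rewrite lisS /= !addn_maxr !geq_max !leq_max.
by rewrite IH /= IHk// addnA leq_add2r IHk// !orbT.
Qed.

Definition lt_cell (x y : nat * nat) := (x.1 < y.1) && (x.2 < y.2).

(** Heights are counted from the bottom while rows are listed from the top, whence the
    index [size ws - x.2.+1]. *)
Lemma lis_chain ws i : exists c : seq (nat * nat),
  [/\ size c = lis ws i, sorted lt_cell c &
   all (fun x => [&& x.1 < i, x.2 < size ws &
     nth false (nth [::] ws (size ws - x.2.+1)) x.1]) c].
Proof.
elim: ws i => [|w ws IHr] i; first by exists [::].
elim: i => [|i [c [sc pc ac]]]; first by exists [::]; rewrite lis0.
rewrite lisS /maxn.
have wk (p : nat) (c' : seq (nat * nat)) : p <= i.+1 -> all (fun x => [&& x.1 < p, x.2 < size ws &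
     nth false (nth [::] ws (size ws - x.2.+1)) x.1]) c' ->
     all (fun x => [&& x.1 < i.+1, x.2 < size (w :: ws) &
     nth false (nth [::] (w :: ws) (size (w :: ws) - x.2.+1)) x.1]) c'.
  move=> pi; apply: sub_all => x /= /and3P[x1 x2 x3].
  rewrite (leq_trans x1 pi) (leqW x2) /= subSS.
  by rewrite -(subnSK x2).
have [c1 [sc1 pc1 ac1]] := IHr i.+1.
have [c2 [sc2 pc2 ac2]] := IHr i.
case: ifP => _; last first.
  case: ifP => _; last first.
    exists c; split => //; apply: sub_all ac => x /= /and3P[x1 -> ->].
    by rewrite (leqW x1).
  by exists c1; split => //; apply: wk ac1.
case wi: (nth false w i); last by exists c2; rewrite addn0; split => //; apply: wk ac2.
exists (rcons c2 (i, size ws)); split.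
- by rewrite size_rcons sc2 addn1.
- case: c2 {sc2} pc2 ac2 => // x c2 /= pc2 ac2; rewrite rcons_path pc2 /=.
  have /allP/(_ _ (mem_last x c2)) := ac2 : all _ (x :: c2).
  by rewrite /lt_cell /= => /and3P[-> -> _].
- by rewrite all_rcons /= ltnSn ltnSn subnn /= wi /=; apply: wk ac2.
Qed.

Lemma lis_le ws i : lis ws i <= i.
Proof.
elim: ws i => [|w ws IHr] i //; elim: i => [|i IH]; first by rewrite lis0.
rewrite lisS !geq_max (leqW IH) IHr /=.
by rewrite -addn1 leq_add// leq_b1.
Qed.

End LastPassage.

(** * Fluctuations of sums of coins *)

Section Deviations.
Context {R : realType}.
Implicit Types (a t : R) (s : seq bool).

Definition dev a s k : R := (count id (take k s))%:R - a * k%:R.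

(** The fourth moment is of order n^2, not n: this is what makes the sum over all k of
    the k-th deviations in [maxdev] negligible. *)
Lemma expect_count_moments a n : 0 <= a <= 1 ->
  let f s := (count id s)%:R - a * n%:R in
  [/\ expect (iid (coin a) n) f = 0,
      expect (iid (coin a) n) (fun s => f s ^+ 2) <= n%:R &
      expect (iid (coin a) n) (fun s => f s ^+ 4) <= 3 * n%:R ^+ 2].
Proof.
move=> a01 /=; elim: n => [|n [IH1 IH2 IH4]].
  by rewrite !expect_iid0 /= !mulr0 !subrr !expr0n /=; split; rewrite // mulr0.
set e := iid (coin a) n in IH1 IH2 IH4 *.
have eL : law_on _ e := law_iid n (law_coin a01).
pose f (s : seq bool) : R := (count id s)%:R - a * n%:R.
have {}IH1 : expect e f = 0 := IH1.
have {}IH2 : expect e (fun s => f s ^+ 2) <= n%:R := IH2.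
have {}IH4 : expect e (fun s => f s ^+ 4) <= 3 * n%:R ^+ 2 := IH4.
have fS x s : (count id (x :: s))%:R - a * n.+1%:R = (x%:R - a) + f s.
  by rewrite /f /= natrD -(natr1 n); lra.
have f1 c : expect e (fun s => c + f s) = c.
  by rewrite expectD IH1 (expect_cst _ eL) addr0.
have f2 c : expect e (fun s => (c + f s) ^+ 2) = c ^+ 2 + expect e (fun s => f s ^+ 2).
  transitivity (expect e (fun s => (c ^+ 2 + (2 * c) * f s) + f s ^+ 2)).
    by apply: eq_expect => s; lra.
  by rewrite !expectD expectZ IH1 (expect_cst _ eL); lra.
have f4 c : expect e (fun s => (c + f s) ^+ 4) = c ^+ 4 + 6 * c ^+ 2 * expect e (fun s => f s ^+ 2) +
    4 * c * expect e (fun s => f s ^+ 3) + expect e (fun s => f s ^+ 4).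
  transitivity (expect e (fun s => (((c ^+ 4 + (4 * c ^+ 3) * f s) + (6 * c ^+ 2) * f s ^+ 2) +
     (4 * c) * f s ^+ 3) + f s ^+ 4)).
    by apply: eq_expect => s; lra.
  by rewrite !expectD !expectZ IH1 (expect_cst _ eL); lra.
have v0 : 0 <= expect e (fun s => f s ^+ 2) by apply: (expect_ge0 eL) => s _; exact: sqr_ge0.
have n0 : 0 <= n%:R :> R by [].
move/andP: a01 => [a0 a1].
split; rewrite expect_iidS.
- transitivity (expect (coin a) (fun x => x%:R - a)); last by rewrite expect_coin /=; lra.
  apply: eq_expect => x; rewrite -[RHS]f1; apply: eq_expect => s; exact: fS.
- rewrite [leLHS](_ : _ = expect (coin a) (fun x => (x%:R - a) ^+ 2 + expect e (fun s => f s ^+ 2))).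
    rewrite expect_coin -(natr1 n) /=; set v := expect e _ in IH2 v0 *.
    have h : a * (1 - a) <= 1 by nra.
    by lra.
  by apply: eq_expect => x; rewrite -f2; apply: eq_expect => s; rewrite fS.
- rewrite [leLHS](_ : _ = expect (coin a) (fun x => (x%:R - a) ^+ 4 +
    6 * (x%:R - a) ^+ 2 * expect e (fun s => f s ^+ 2) +
    4 * (x%:R - a) * expect e (fun s => f s ^+ 3) + expect e (fun s => f s ^+ 4))).
    rewrite expect_coin -(natr1 n) /=.
    set v := expect e (fun s => f s ^+ 2) in IH2 v0 *.
    set w := expect e (fun s => f s ^+ 3); set z := expect e (fun s => f s ^+ 4) in IH4 *.
    set m : R := n%:R in n0 IH2 IH4 *.
    have -> : a * ((1 - a) ^+ 4 + 6 * (1 - a) ^+ 2 * v + 4 * (1 - a) * w + z) +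
      (1 - a) * ((0 - a) ^+ 4 + 6 * (0 - a) ^+ 2 * v + 4 * (0 - a) * w + z) =
      a * (1 - a) * ((1 - a) ^+ 3 + a ^+ 3) + 6 * (a * (1 - a)) * v + z by lra.
    have h1 : a * (1 - a) <= 1 by nra.
    have h0 : 0 <= a * (1 - a) by nra.
    have h2 : a * (1 - a) <= 4^-1 by have := sqr_ge0 (a - 2^-1); lra.
    have h3 : (1 - a) ^+ 3 + a ^+ 3 <= 1 by lra.
    have h4 : a * (1 - a) * ((1 - a) ^+ 3 + a ^+ 3) <= 1.
      have := ler_wpM2l h0 h3; lra.
    have h5 : a * (1 - a) * v <= 4^-1 * m by exact: ler_pM.
    by lra.
  apply: eq_expect => x; rewrite -f4; apply: eq_expect => s; by rewrite fS.
Qed.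

Lemma expect_iid_take a n k (f : seq bool -> R) : 0 <= a <= 1 -> (k <= n)%N ->
  expect (iid (coin a) n) (fun s => f (take k s)) = expect (iid (coin a) k) f.
Proof.
move=> a01 kn; rewrite -{1}(subnKC kn) expect_iid_cat.
apply: (eq_expect_on (law_iid k (law_coin a01))) => s /andP[/eqP sk _].
rewrite -[RHS](expect_cst _ (law_iid (n - k)%N (law_coin a01))).
by apply: eq_expect => u; rewrite take_size_cat.
Qed.

(** A bound for all deviations up to time [n] at once: either a deviation is at most [t],
    or it is at most its fourth power divided by t^3. *)
Definition maxdev a t n s : R := t + (\sum_(k < n.+1) dev a s k ^+ 4) / t ^+ 3.

Lemma maxdev_ge0 a t n s : 0 < t -> 0 <= maxdev a t n s.
Proof.
move=> t0; apply: addr_ge0; first exact: ltW.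
apply: divr_ge0; last by apply: exprn_ge0; exact: ltW.
by apply: sumr_ge0 => k _; rewrite exprn_even_ge0.
Qed.

Lemma dev_le_maxdev a t n s k : 0 < t -> (k <= n)%N ->
  `|dev a s k| <= maxdev a t n s.
Proof.
move=> t0 kn; rewrite /maxdev.
set x := dev a s k.
have h : x ^+ 4 <= \sum_(k < n.+1) dev a s k ^+ 4.
  rewrite (bigD1 (Ordinal (kn : (k < n.+1)%N))) //= lerDl.
  by apply: sumr_ge0 => i _; rewrite exprn_even_ge0.
have t3 : 0 < t ^+ 3 by apply: exprn_gt0.
have [xt|xt] := leP `|x| t.
  apply: (le_trans xt); rewrite lerDl; apply: divr_ge0; last exact: ltW.
  by apply: sumr_ge0 => i _; rewrite exprn_even_ge0.
apply: (@le_trans _ _ (0 + x ^+ 4 / t ^+ 3)); last first.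
  by apply: lerD; [exact: ltW|rewrite ler_pM2r// invr_gt0].
rewrite add0r ler_pdivlMr//.
have -> : x ^+ 4 = `|x| * `|x| ^+ 3 by rewrite -exprS -normrX ger0_norm// exprn_even_ge0.
apply: ler_wpM2l => //; rewrite lerXn2r ?nnegrE//; exact: ltW.
Qed.

Lemma expect_maxdev a t n : 0 <= a <= 1 -> 0 < t ->
  expect (iid (coin a) n) (maxdev a t n) <= t + 3 * (n.+1)%:R * n%:R ^+ 2 / t ^+ 3.
Proof.
move=> a01 t0; have L := law_iid n (law_coin a01).
have t3 : 0 < t ^+ 3 by apply: exprn_gt0.
rewrite /maxdev expectD (expect_cst _ L) expectZr lerD2l ler_pM2r ?invr_gt0// expect_sum.
apply: (@le_trans _ _ (\sum_(k < n.+1) 3 * n%:R ^+ 2)); last first.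
  by rewrite sumr_const card_ord -mulr_natl; lra.
apply: ler_sum => k _; have kn : (k <= n)%N by rewrite -ltnS.
have := @expect_iid_take a n k (fun s => ((count id s)%:R - a * k%:R) ^+ 4) a01 kn.
rewrite /dev => ->; have [_ _] := expect_count_moments k a01 => /le_trans; apply.
by rewrite ler_pM2l// lerXn2r ?nnegrE// ler_nat.
Qed.

End Deviations.

(** * Comparison of three stationary systems *)

Section Pointwise.
Context {R : realType}.
Variables (n : nat) (ws : seq (seq bool)) (M : R).
Hypotheses (sws : size ws = n) (aws : all (fun w => size w == n) ws).

Definition close_run (a b : R) (I bs : seq bool) :=
  [/\ size I = n /\ size bs = n, (forall k, (k <= n)%N -> `|dev a I k| <= M),
      (forall k, (k <= n)%N -> `|dev b bs k| <= M) &
      `|dev a (profile I bs ws) n| <= M].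

(** The value of the square is the number of sinks plus the number of increments along the
    top, so it concentrates as soon as both sums do. *)
Lemma close_lpp a b I bs : close_run a b I bs ->
  `|(lpp I bs ws n)%:R - (a + b) * n%:R| <= 2 * M.
Proof.
move=> [[sI sb] _ /(_ n (leqnn n)) h2 h3].
rewrite lpp_profile ?sb ?sI// natrD.
move: h2 h3; rewrite /dev -[in X in take X bs]sb take_size !ler_norml => /andP[? ?] /andP[? ?].
by apply/andP; split; lra.
Qed.

(** Apply [lpp_exit] to the symmetric system.  If the exit distance is at most e n, the
    boundary contributes at most a0 e n and the rest is at most [lis].  If it is larger,
    replace the boundary points of the symmetric system by those of the tilted system
    with more points on that side: its value would exceed (a1 + b1) n by rho n, where
    rho > 0, so the deviations are at least of order rho n and the inequality holds
    because its left side is then at most 0. *)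
Lemma lis_ge_stationary (a0 a1 b1 e rho : R) I0 bs0 I1 bs1 I2 bs2 :
  0 <= a0 -> a0 <= a1 -> 0 <= e -> 0 < rho ->
  rho <= (a1 - a0) * e - (a1 + b1 - 2 * a0) ->
  close_run a0 a0 I0 bs0 -> close_run a1 b1 I1 bs1 -> close_run b1 a1 I2 bs2 ->
  (2 - e) * a0 * n%:R - (4 + 16 * a0 / rho) * M <= (lis ws n)%:R.
Proof.
move=> a00 a01 e0 rho0 rhoE C0 C1 C2.
have := close_lpp C0; have := close_lpp C1; have := close_lpp C2.
rewrite !ler_norml => /andP[_ g2] /andP[_ g1] /andP[g0 _].
case: C0 => -[sI0 sb0] dI0 db0 _; case: C1 => -[sI1 sb1] dI1 _ _.
case: C2 => -[sI2 sb2] _ db2 _.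
have M0 : 0 <= M by apply: le_trans (dI0 0%N isT); exact: normr_ge0.
have n0 : 0 <= n%:R :> R by [].
have en0 : 0 <= e * n%:R by rewrite mulr_ge0.
have ean0 : 0 <= a0 * (e * n%:R) by rewrite mulr_ge0.
have K : 0 <= a0 / rho * M by rewrite mulr_ge0// divr_ge0// ltW.
(* The two cases of the exit distance: up to e n, and beyond. *)
have rE : 16 * a0 / rho = 16 * (a0 / rho) by rewrite mulrA.
have small : (2 - e) * a0 * n%:R - 4 * M <= (lis ws n)%:R ->
    (2 - e) * a0 * n%:R - (4 + 16 * a0 / rho) * M <= (lis ws n)%:R.
  by rewrite rE; lra.
have large : rho * n%:R <= 8 * M ->
    (2 - e) * a0 * n%:R - (4 + 16 * a0 / rho) * M <= (lis ws n)%:R.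
  move=> h; have : a0 / rho * (rho * n%:R) <= a0 / rho * (8 * M).
    by apply: ler_wpM2l => //; rewrite divr_ge0// ltW.
  rewrite [a0 / rho * (rho * _)]mulrA divfK ?gt_eqF// => h'.
  have x0 : 0 <= (lis ws n)%:R :> R by [].
  by rewrite rE; lra.
have rhon : rho * n%:R <= ((a1 - a0) * e - (a1 + b1 - 2 * a0)) * n%:R.
  exact: ler_wpM2r.
case: (@lpp_exit I0 bs0 ws n); first by rewrite sb0 sws.
- case=> k kn; rewrite -(ler_nat R) natrD => hk.
  have := dI0 k kn; rewrite /dev ler_norml => /andP[_ d0].
  have [ken|ken] := leP (k%:R : R) (e * n%:R).
    apply: small.
    have : (lis (map (drop k) ws) (n - k) <= lis ws n)%N.
      have := @lpp_ge_source [::] (nseq (size ws) false) ws k (n - k).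
      rewrite size_nseq => /(_ erefl).
      by rewrite subnKC// /lis; apply: leq_trans; exact: leq_addl.
    rewrite -(ler_nat R) => hL.
    have := ler_wpM2l a00 ken; lra.
  apply: large.
  have := @lpp_ge_source I1 bs1 ws k (n - k).
  rewrite sb1 sws => /(_ erefl); rewrite subnKC// -(ler_nat R) natrD => h1.
  have := dI1 k kn; rewrite /dev ler_norml => /andP[d1 _].
  have a10 : 0 <= a1 - a0 by rewrite subr_ge0.
  have := ler_wpM2l a10 (ltW ken); lra.
- rewrite sws => -[k kn]; rewrite -(ler_nat R) natrD => hk.
  have cd (bs : seq bool) : size bs = n -> (count id (drop k bs))%:R =
      (count id (take n bs))%:R - (count id (take k bs))%:R :> R.
    move=> sb; rewrite -{1}sb take_size.
    have := count_cat id (take k bs) (drop k bs); rewrite cat_take_drop => ->.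
    by rewrite natrD; lra.
  have := db0 k kn; rewrite /dev ler_norml => /andP[d0 _].
  have := db0 n (leqnn n); rewrite /dev ler_norml => /andP[_ d0n].
  rewrite (cd _ sb0) in hk.
  have hn : (n - k)%:R = n%:R - k%:R :> R by rewrite natrB.
  have [ken|ken] := leP ((n - k)%:R : R) (e * n%:R); rewrite hn in ken.
    apply: small.
    have : (lis (take k ws) n <= lis ws n)%N.
      have := @lpp_ge_sink [::] (nseq (size ws) false) ws k n.
      rewrite size_nseq => /(_ erefl).
      by rewrite /lis; apply: leq_trans; exact: leq_addl.
    rewrite -(ler_nat R) => hL.
    have := ler_wpM2l a00 ken; lra.
  apply: large.
  have := @lpp_ge_sink I2 bs2 ws k n.
  rewrite sb2 sws => /(_ erefl); rewrite -(ler_nat R) natrD (cd _ sb2) => h1.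
  have := db2 k kn; rewrite /dev ler_norml => /andP[_ d2].
  have := db2 n (leqnn n); rewrite /dev ler_norml => /andP[d2n _].
  have a10 : 0 <= a1 - a0 by rewrite subr_ge0.
  have := ler_wpM2l a10 (ltW ken); lra.
Qed.

End Pointwise.

(** * The mean of the longest chain in a lattice square *)

Section MeanLis.
Context {R : realType}.

Definition coin_field (q : R) n m := iid (iid (coin q) n) m.

Lemma law_coin_field (q : R) n m : 0 <= q <= 1 ->
  law_on (fun ws => (size ws == m) && all (fun w => size w == n) ws) (coin_field q n m).
Proof.
move=> q01; have [] := law_iid m (law_iid n (law_coin q01)).
move=> h ?; split => //; apply: sub_all h => x /andP[-> /andP[-> /=]].
by apply: sub_all => w /andP[].
Qed.

(** By [Burke_profile] the increments along the top have the law of the sources. *)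
Lemma run_maxdev (a b q t : R) n : 0 <= a <= 1 -> 0 <= b <= 1 -> 0 <= q <= 1 ->
  a * b = q * (1 - a) * (1 - b) -> 0 < t ->
  expect (coin_field q n n) (fun ws => expect (iid (coin a) n) (fun I => expect (iid (coin b) n) (fun bs =>
    maxdev a t n I + maxdev b t n bs + maxdev a t n (profile I bs ws)))) <=
  3 * (t + 3 * (n.+1)%:R * n%:R ^+ 2 / t ^+ 3).
Proof.
move=> a01 b01 q01 abq t0.
have La := law_iid n (law_coin a01); have Lb := law_iid n (law_coin b01).
have Lq := law_coin_field n n q01.
rewrite [leLHS](_ : _ = expect (iid (coin a) n) (maxdev a t n) +
    expect (iid (coin b) n) (maxdev b t n) + expect (iid (coin a) n) (maxdev a t n)).
  have := expect_maxdev n a01 t0; have := expect_maxdev n b01 t0; lra.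
rewrite -[X in _ = _ + X](Burke_profile abq n n) expect_swap -/(coin_field q n n).
transitivity (expect (iid (coin a) n) (fun I => maxdev a t n I +
  (expect (iid (coin b) n) (maxdev b t n) + expect (iid (coin b) n) (fun bs => expect (coin_field q n n)
    (fun ws => maxdev a t n (profile I bs ws)))))).
  apply: eq_expect => I; rewrite expect_swap.
  rewrite -expectD -[X in _ = X + _](expect_cst _ Lb) -expectD; apply: eq_expect => bs.
  by rewrite [LHS]expectD (expect_cst _ Lq) -[LHS]addrA.
by rewrite [LHS]expectD -[RHS]addrA; congr (_ + _); rewrite [LHS]expectD (expect_cst _ La).
Qed.

Lemma ge_expect A Q (d : seq (R * A)) c f : law_on Q d -> (forall x, Q x -> c <= f x) ->
  c <= expect d f.
Proof. by move=> dQ cf; rewrite -(expect_cst c dQ); exact: (le_expect dQ). Qed.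

(** With q = r^2 the symmetric density is r / (1 + r).  The tilted one uses odds
    u = r (1 + e) and q / u, for which rho is proportional to
    e^2 r + 2 e r^2 > 0. *)
Lemma expect_lis (r e : R) : 0 < r < 1 -> 0 < e < 1 ->
  exists2 n, (0 < n)%N &
    (2 - 2 * e) * (r / (1 + r)) * n%:R <=
      expect (coin_field (r ^+ 2) n n) (fun ws => (lis ws n)%:R).
Proof.
move=> /andP[r0 r1] /andP[e0 e1].
set q := r ^+ 2; pose u := r * (1 + e).
have q0 : 0 < q by apply: exprn_gt0.
have q01 : 0 <= q <= 1 by rewrite ltW//= /q expr_le1// ltW.
have u0 : 0 < u by rewrite mulr_gt0// ltr_wpDr// ltW.
set x := (1 + u)^-1; set y := (u + q)^-1; set z := (1 + r)^-1.
have x0 : 0 < x by rewrite invr_gt0; lra.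
have y0 : 0 < y by rewrite invr_gt0; lra.
have z0 : 0 < z by rewrite invr_gt0; lra.
have xE : x * (1 + u) = 1 by rewrite mulVf// gt_eqF//; lra.
have yE : y * (u + q) = 1 by rewrite mulVf// gt_eqF//; lra.
have zE : z * (1 + r) = 1 by rewrite mulVf// gt_eqF//; lra.
pose a0 := r * z; pose a1 := u * x; pose b1 := q * y.
have a0E : 1 - a0 = z by rewrite /a0; lra.
have a1E : 1 - a1 = x by rewrite /a1; lra.
have b1E : 1 - b1 = u * y by rewrite /b1; lra.
have a0_gt0 : 0 < a0 by rewrite mulr_gt0.
have a001 : 0 <= a0 <= 1 by apply/andP; split; [exact: ltW|rewrite -subr_ge0 a0E ltW].
have a101 : 0 <= a1 <= 1 by apply/andP; split; [rewrite mulr_ge0// ltW|rewrite -subr_ge0 a1E ltW].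
have b101 : 0 <= b1 <= 1 by apply/andP; split; [|rewrite -subr_ge0 b1E]; rewrite mulr_ge0// ltW.
have st0 : a0 * a0 = q * (1 - a0) * (1 - a0) by rewrite a0E /a0 /q expr2; lra.
have st1 : a1 * b1 = q * (1 - a1) * (1 - b1) by rewrite a1E b1E /a1 /b1; lra.
have st2 : b1 * a1 = q * (1 - b1) * (1 - a1) by rewrite a1E b1E /a1 /b1; lra.
have d1 : a1 - a0 = (u - r) * (x * z).
  have -> : a1 - a0 = u * x * (z * (1 + r)) - r * z * (x * (1 + u)).
    by rewrite xE zE !mulr1.
  by lra.
have d2 : b1 - a0 = - (u - r) * (r * y * z).
  have -> : b1 - a0 = q * y * (z * (1 + r)) - r * z * (y * (u + q)).
    by rewrite yE zE !mulr1.
  by rewrite /q expr2; lra.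
have ur : u - r = r * e by rewrite /u; lra.
have a0a1 : a0 <= a1 by rewrite -subr_ge0 d1 ur !mulr_ge0// ltW.
pose rho := (a1 - a0) * e - (a1 + b1 - 2 * a0).
have rho0 : 0 < rho.
  have -> : rho = (u - r) * z * (x * y * (e ^+ 2 * r + 2 * e * r ^+ 2)).
    rewrite /rho; have -> : a1 + b1 - 2 * a0 = (a1 - a0) + (b1 - a0) by lra.
    rewrite d1 d2.
    have -> : (u - r) * (x * z) * e - ((u - r) * (x * z) + - (u - r) * (r * y * z)) =
      (u - r) * z * (x * e * (y * (u + q)) - x * (y * (u + q)) + r * y * (x * (1 + u))).
      by rewrite xE yE; lra.
    by congr (_ * _); rewrite /u /q; lra.
  by rewrite ur !mulr_gt0// addr_gt0// !mulr_gt0// exprn_gt0.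
pose C := 4 + 16 * a0 / rho.
have C0 : 0 < C by rewrite ltr_wpDr// divr_ge0// ?mulr_ge0// ltW.
pose eta := e * a0 / (18 * C).
have eta0 : 0 < eta by rewrite divr_gt0// mulr_gt0.
pose n := (Num.truncn (108 * C / (eta ^+ 3 * (e * a0)))).+1.
have nE : 108 * C / (eta ^+ 3 * (e * a0)) <= n%:R by rewrite ltW// truncnS_gt.
exists n => //.
have n0 : 0 < n%:R :> R by rewrite ltr0n.
pose t := eta * n%:R.
have t0 : 0 < t by rewrite mulr_gt0.
have pw (a b : R) (I bs : seq bool) ws : size I = n -> size bs = n ->
    all (fun w => size w == n) ws -> forall M,
    maxdev a t n I + maxdev b t n bs + maxdev a t n (profile I bs ws) <= M ->
    close_run n ws M a b I bs.
  move=> sI sb sw M hM.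
  have m1 := maxdev_ge0 a n I t0; have m2 := maxdev_ge0 b n bs t0.
  have m3 := maxdev_ge0 a n (profile I bs ws) t0.
  split => [//|k kn|k kn|].
  - by apply: le_trans (dev_le_maxdev a I t0 kn) _; lra.
  - by apply: le_trans (dev_le_maxdev b bs t0 kn) _; lra.
  - by apply: le_trans (dev_le_maxdev a _ t0 (leqnn n)) _; lra.
pose psi (a b : R) ws (I bs : seq bool) := maxdev a t n I + maxdev b t n bs + maxdev a t n (profile I bs ws).
pose Psi a b ws := expect (iid (coin a) n) (fun I => expect (iid (coin b) n) (psi a b ws I)).
have avg a b (A B : R) ws : 0 <= a <= 1 -> 0 <= b <= 1 ->
    (forall I bs, size I = n -> size bs = n -> A <= B + C * psi a b ws I bs) ->
    A <= B + C * Psi a b ws.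
  move=> a01 b01 h; have La := law_iid n (law_coin a01); have Lb := law_iid n (law_coin b01).
  rewrite -lerBlDl /Psi -expectZ; apply: (ge_expect La) => I /andP[/eqP sI _].
  rewrite -expectZ; apply: (ge_expect Lb) => bs /andP[/eqP sb _].
  by rewrite lerBlDl; exact: h.
have main ws : (size ws == n) && all (fun w => size w == n) ws ->
    (2 - e) * a0 * n%:R <= (lis ws n)%:R + C * Psi a0 a0 ws + C * Psi a1 b1 ws + C * Psi b1 a1 ws.
  move=> /andP[/eqP sw aw].
  apply: (avg) => // I2 bs2 sI2 sb2; rewrite [leRHS]addrAC.
  apply: (avg) => // I1 bs1 sI1 sb1; rewrite -[leRHS]addrA [leRHS]addrAC.
  apply: (avg) => // I0 bs0 sI0 sb0.
  pose M := psi a0 a0 ws I0 bs0 + psi a1 b1 ws I1 bs1 + psi b1 a1 ws I2 bs2.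
  have p0 a b I bs : 0 <= psi a b ws I bs by apply: addr_ge0; [apply: addr_ge0|]; exact: maxdev_ge0.
  have := @lis_ge_stationary R n ws M sw aw a0 a1 b1 e rho I0 bs0 I1 bs1 I2 bs2.
  move=> /(_ (ltW a0_gt0) a0a1 (ltW e0) rho0 (lexx _)).
  have P0 := p0 a0 a0 I0 bs0; have P1 := p0 a1 b1 I1 bs1; have P2 := p0 b1 a1 I2 bs2.
  have k0 : close_run n ws M a0 a0 I0 bs0 by apply: pw => //; rewrite -/(psi _ _ _ _ _) /M; lra.
  have k1 : close_run n ws M a1 b1 I1 bs1 by apply: pw => //; rewrite -/(psi _ _ _ _ _) /M; lra.
  have k2 : close_run n ws M b1 a1 I2 bs2 by apply: pw => //; rewrite -/(psi _ _ _ _ _) /M; lra.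
  by move=> /(_ k0 k1 k2); rewrite -/C /M; lra.
have Lq := law_coin_field n n q01.
have := ge_expect Lq main; rewrite !expectD !expectZ -/(coin_field q n n) => hL.
have B0 : expect (coin_field q n n) (Psi a0 a0) <= _ := run_maxdev n a001 a001 q01 st0 t0.
have B1 : expect (coin_field q n n) (Psi a1 b1) <= _ := run_maxdev n a101 b101 q01 st1 t0.
have B2 : expect (coin_field q n n) (Psi b1 a1) <= _ := run_maxdev n b101 a101 q01 st2 t0.
set D := 3 * (t + _) in B0 B1 B2.
have hD : C * (3 * D) <= e * a0 * n%:R.
  have eta3 : 0 < eta ^+ 3 by apply: exprn_gt0.
  have ea0 : 0 < e * a0 by rewrite mulr_gt0.
  have s1 : 3 * (n.+1)%:R * n%:R ^+ 2 / t ^+ 3 <= 6 / eta ^+ 3.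
    have t3 : t ^+ 3 = eta ^+ 3 * n%:R ^+ 3 by exact: exprMn.
    rewrite ler_pdivrMr ?exprn_gt0// t3 [leRHS]mulrA divfK ?gt_eqF//.
    rewrite [n%:R ^+ 3]exprS [leRHS]mulrA ler_pM2r ?exprn_gt0// -natr1.
    have : 1 <= n%:R :> R by rewrite ler1n.
    lra.
  have s2 : 18 * C * t = e * a0 * n%:R.
    have etaE : 18 * C * eta = e * a0 by rewrite /eta mulrC divfK// gt_eqF// mulr_gt0.
    by rewrite /t mulrA etaE.
  have s3 : 18 * C * (6 / eta ^+ 3) <= e * a0 * n%:R.
    have ee : 0 < eta ^+ 3 * (e * a0) := mulr_gt0 eta3 ea0.
    move: nE; rewrite (ler_pdivrMr _ _ ee) => nE'.
    rewrite [leLHS]mulrA (ler_pdivrMr _ _ eta3); lra.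
  have : C * (3 * D) <= C * (3 * (3 * (t + 6 / eta ^+ 3))).
    by rewrite ler_pM2l// /D; lra.
  lra.
have h0 := ler_wpM2l (ltW C0) B0; have h1 := ler_wpM2l (ltW C0) B1.
have h2 := ler_wpM2l (ltW C0) B2.
rewrite -[r / _]/a0; lra.
Qed.

End MeanLis.

(** * Concentration over independent blocks *)

Section Chernoff.
Context {R : realType}.

Lemma expRN_le (y : R) : 0 <= y -> expR (- y) <= 1 - y + y ^+ 2.
Proof.
move=> y0; have y1 : 0 < 1 + y by lra.
rewrite expRN; apply: (@le_trans _ _ (1 + y)^-1).
  by rewrite lef_pV2 ?posrE ?expR_gt0// expR_ge1Dx.
rewrite -[leLHS]mul1r ler_pdivrMr//.
have : 0 <= y ^+ 3 by apply: exprn_ge0.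
lra.
Qed.

Lemma expect_iid_prod A (d : seq (R * A)) n (g : A -> R) :
  expect (iid d n) (fun s => \prod_(x <- s) g x) = (expect d g) ^+ n.
Proof.
elim: n => [|n IH]; first by rewrite expect_iid0 big_nil.
rewrite expect_iidS exprS -expectZr; apply: eq_expect => x.
by rewrite -IH -expectZ; apply: eq_expect => s; rewrite big_cons.
Qed.

(** Markov's inequality for exp (- tau S) with tau = delta / (2 B^2). *)
Lemma Chernoff_lower A (Q : pred A) (d : seq (R * A)) (X : A -> R) (B m delta : R) :
  law_on Q d -> 0 < B -> (forall x, Q x -> 0 <= X x <= B) -> m <= expect d X -> 0 < delta ->
  exists2 kappa : R, 0 < kappa & forall n,
    expect (iid d n) (fun s => (\sum_(x <- s) X x <= (m - delta) * n%:R)%R%:R) <=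
      expR (- (kappa * n%:R)).
Proof.
move=> dQ B0 XB mX de0.
pose tau := delta / (2 * B ^+ 2); pose kappa := tau * delta / 2.
have BB : 0 < B ^+ 2 by apply: exprn_gt0.
have tau0 : 0 < tau by rewrite divr_gt0// mulr_gt0.
have tauE : tau * (2 * B ^+ 2) = delta by rewrite /tau divfK// gt_eqF// mulr_gt0.
have kap : tau * (delta - tau * B ^+ 2) = kappa.
  have -> : tau * B ^+ 2 = delta / 2 by lra.
  by rewrite /kappa; lra.
exists kappa; first by rewrite divr_gt0// mulr_gt0.
move=> n; have L := law_iid n dQ.
have one : expect d (fun x => expR (- (tau * X x))) <= expR (- (tau * m) + tau ^+ 2 * B ^+ 2).
  apply: (@le_trans _ _ (1 + (- (tau * m) + tau ^+ 2 * B ^+ 2))); last exact: expR_ge1Dx.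
  apply: (@le_trans _ _ (expect d (fun x => (1 + (- tau) * X x) + tau ^+ 2 * B ^+ 2))).
    apply: (le_expect dQ) => x /XB /andP[X0 X1].
    apply: le_trans (expRN_le (mulr_ge0 (ltW tau0) X0)) _.
    have : (tau * X x) ^+ 2 <= tau ^+ 2 * B ^+ 2.
      rewrite exprMn ler_pM2l ?exprn_gt0// lerXn2r// nnegrE// ltW//.
    lra.
  rewrite [leLHS]expectD [X in X + _]expectD !(expect_cst _ dQ).
  have -> : expect d (fun x => - tau * X x) = - tau * expect d X by exact: expectZ.
  have := ler_wpM2l (ltW tau0) mX.
  lra.
apply: (@le_trans _ _ (expect (iid d n) (fun s => expR (tau * ((m - delta) * n%:R)) *
    \prod_(x <- s) expR (- (tau * X x))))).
  apply: (le_expect L) => s _.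
  rewrite -(big_morph _ (@expRD R) (@expR0 R)) -expRD sumrN -mulr_sumr.
  case: (leP (\sum_(x <- s) X x) _) => h /=; last exact: expR_ge0.
  by rewrite -[leLHS](@expR0 R) ler_expR -mulrBr mulr_ge0 ?subr_ge0// ltW.
rewrite expectZ expect_iid_prod.
apply: (@le_trans _ _ (expR (tau * ((m - delta) * n%:R)) *
    expR (- (tau * m) + tau ^+ 2 * B ^+ 2) ^+ n)).
  rewrite ler_pM2l ?expR_gt0// lerXn2r// nnegrE; last exact: expR_ge0.
  by apply: (expect_ge0 dQ) => x _; exact: expR_ge0.
rewrite -expRM_natr -expRD ler_expR -kap; lra.
Qed.

End Chernoff.

Section Bernoulli_product.
Context {R : realType}.

Fixpoint coins (qs : seq R) : seq (R * seq bool) :=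
  if qs is q :: qs' then
    [seq (x.1 * y.1, x.2 :: y.2) | x <- coin q, y <- coins qs']
  else [:: (1, [::])].

Lemma expect_coins_nil f : expect (coins [::]) f = f [::].
Proof. by rewrite /expect big_seq1 mul1r. Qed.

Lemma expect_coins_cons q qs f : expect (coins (q :: qs)) f =
  q * expect (coins qs) (fun s => f (true :: s)) +
  (1 - q) * expect (coins qs) (fun s => f (false :: s)).
Proof.
rewrite -(expect_coin q (fun b => expect (coins qs) (fun s => f (b :: s)))).
rewrite /expect big_allpairs_dep; apply: eq_bigr => x _.
by rewrite mulr_sumr; apply: eq_bigr => y _; rewrite mulrA.
Qed.

Lemma law_coins qs : all (fun q => 0 <= q <= 1) qs ->
  law_on (fun s => size s == size qs) (coins qs).
Proof.
elim: qs => [|q qs IH].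
  by split; [rewrite /= ler01|rewrite expect_coins_nil].
move=> /andP[/andP[q0 q1] /IH[hq h1]]; split; last first.
  by rewrite expect_coins_cons h1; lra.
rewrite /= cats0 all_cat !all_map; apply/andP; split; apply: sub_all hq => y /= /andP[y0 sy];
  rewrite eqSS sy andbT mulr_ge0//.
by rewrite subr_ge0.
Qed.

Definition antitone (f : seq bool -> R) := forall s t, size s = size t ->
  (forall i, nth false s i -> nth false t i) -> f t <= f s.

(** Changing the densities one at a time, each change moves weight from a configuration
    to one with an extra occupied cell. *)
Lemma expect_coins_le (q : R) qs f : antitone f -> all (fun q' => q <= q' <= 1) qs -> 0 <= q ->
  expect (coins qs) f <= expect (iid (coin q) (size qs)) f.
Proof.
move=> + + q0; elim: qs f => [|q' qs IH] f af; first by move=> _; rewrite !expect_coins_nil.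
move=> /andP[/andP[qq' q'1] hqs].
have at_ b : antitone (fun s => f (b :: s)).
  by move=> s t st h; apply: af => [/=|[|i] //=]; [rewrite st|exact: h].
have L : law_on (fun s => size s == size qs) (coins qs).
  by apply: law_coins; apply: sub_all hqs => x /andP[qx ->]; rewrite (le_trans q0 qx).
rewrite [leLHS]expect_coins_cons [size (_ :: _)]/= [leRHS]expect_iidS expect_coin.
have ht := IH _ (at_ true) hqs; have hf := IH _ (at_ false) hqs.
have htf : expect (coins qs) (fun s => f (true :: s)) <= expect (coins qs) (fun s => f (false :: s)).
  by apply: (le_expect L) => s _; apply: af => // -[|i].
move: htf ht hf; set x := expect (coins qs) _; set y := expect (coins qs) _.
set x' := expect (iid _ _) _; set y' := expect (iid _ _) _ => h1 h2 h3.
have e1 : 0 <= (q' - q) * (y - x) by rewrite mulr_ge0// subr_ge0.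
have e2 : 0 <= q * (x' - x) by rewrite mulr_ge0// subr_ge0.
have e3 : 0 <= (1 - q) * (y' - y) by rewrite mulr_ge0 ?subr_ge0// (le_trans qq').
lra.
Qed.

Lemma expect_iid_flatten A (d : seq (R * A)) m n f :
  expect (iid (iid d m) n) (fun s => f (flatten s)) = expect (iid d (n * m)) f.
Proof.
elim: n f => [|n IH] f; first by rewrite !expect_iid0.
rewrite expect_iidS mulSn expect_iid_cat; apply: eq_expect => s /=.
exact: (IH (fun t => f (s ++ t))).
Qed.

End Bernoulli_product.

Section Blocks.
Context {R : realType}.

Lemma leq_b1_mono (b c : bool) : (b -> c) -> (b <= c)%N.
Proof. by case: b; case: c => // /(_ isT). Qed.


Definition grid (B : nat) (s : seq bool) := reshape (nseq B B) s.

(** The list of occupations is read as [N] consecutive blocks of [B * B] cells. *)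
Definition blocksum (B N : nat) (s : seq bool) : nat :=
  (\sum_(b <- reshape (nseq N (B * B)) s) lis (grid B b) B)%N.

Lemma lis_mono ws ws' i : size ws = size ws' ->
  (forall j k, nth false (nth [::] ws j) k -> nth false (nth [::] ws' j) k) ->
  (lis ws i <= lis ws' i)%N.
Proof.
elim: ws ws' i => [|w ws IHr] [|w' ws'] i //= [sw] h.
have hr j k : nth false (nth [::] ws j) k -> nth false (nth [::] ws' j) k by exact: (h j.+1).
elim: i => [|i IH]; first by rewrite !lis0.
rewrite !lisS geq_max geq_max !leq_max IH /= IHr// orbT /=.
rewrite leq_add ?orbT// ?IHr//.
by have := h 0%N i; rewrite /=; case: nth => // ->.
Qed.

Lemma nth_reshape_mono (sh : seq nat) (s t : seq bool) :
  (forall i, nth false s i -> nth false t i) ->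
  forall j k, nth false (nth [::] (reshape sh s) j) k -> nth false (nth [::] (reshape sh t) j) k.
Proof.
move=> h j k; rewrite !nth_reshape.
have [kn|kn] := ltnP k (nth 0 sh j)%N; last first.
  rewrite nth_default// size_take; case: ltnP => // h'; exact: leq_trans kn.
by rewrite !nth_take// !nth_drop; exact: h.
Qed.

Lemma blocksum_mono B N s t : size s = size t ->
  (forall i, nth false s i -> nth false t i) -> (blocksum B N s <= blocksum B N t)%N.
Proof.
move=> st h; rewrite /blocksum !(big_nth [::]) !size_reshape.
apply: leq_sum => i _; apply: lis_mono; first by rewrite !size_reshape.
by apply: nth_reshape_mono; exact: nth_reshape_mono.
Qed.

Lemma blocksum_tail (q m delta : R) B : 0 <= q <= 1 -> (0 < B)%N -> 0 < delta ->
  m <= expect (coin_field q B B) (fun ws => (lis ws B)%:R) ->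
  exists2 kappa : R, 0 < kappa & forall N qs, size qs = (N * (B * B))%N ->
    all (fun q' => q <= q' <= 1) qs ->
    expect (coins qs) (fun s => ((blocksum B N s)%:R <= (m - delta) * N%:R)%R%:R) <=
      expR (- (kappa * N%:R)).
Proof.
move=> q01 B0 de0 hm; have L := law_coin_field B B q01.
have LB := law_iid (B * B)%N (law_coin q01).
have shapeE N (k : nat) (ss : seq (seq bool)) : size ss = N -> all (fun w => size w == k) ss ->
    shape ss = nseq N k.
  by move=> <-; elim: ss => //= w ss IH /andP[/eqP -> /IH ->].
have mean : m <= expect (iid (coin q) (B * B)) (fun b => (lis (grid B b) B)%:R).
  apply: le_trans hm _; rewrite -expect_iid_flatten; apply: (le_expect L) => ws /andP[/eqP sw aw].
  by rewrite /grid -(shapeE B B ws)// flattenK.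
have [||kappa k0 hk] := Chernoff_lower (B := B%:R) LB _ _ mean de0.
- by rewrite ltr0n.
- by move=> b _; rewrite ler0n ler_nat lis_le.
exists kappa => // N qs sqs hqs.
apply: le_trans (hk N).
have [q0 _] := andP q01.
apply: le_trans (expect_coins_le _ hqs q0) _.
  move=> s t st h; rewrite ler_nat leq_b1_mono//.
  by apply: le_trans; rewrite ler_nat blocksum_mono.
rewrite sqs -expect_iid_flatten.
apply: (le_expect (law_iid N LB)) => ss /andP[/eqP sss asss]; rewrite /blocksum.
rewrite -(shapeE N (B * B)%N ss)//; first by rewrite flattenK natr_sum.
by apply: sub_all asss => b /andP[].
Qed.

End Blocks.

(** * Poissonization of the sample *)

Section FineProbability.
Context d (T : measurableType d) (R : realType) (P : probability T R).

Definition pr (A : set T) : R := fine (P A).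

Lemma prE A : measurable A -> P A = (pr A)%:E.
Proof. by move=> mA; rewrite /pr fineK// fin_num_measure. Qed.

Lemma pr_ge0 A : 0 <= pr A. Proof. by rewrite /pr fine_ge0. Qed.

Lemma pr0 : pr set0 = 0. Proof. by rewrite /pr measure0. Qed.

Lemma prU A B : measurable A -> measurable B -> A `&` B = set0 ->
  pr (A `|` B) = pr A + pr B.
Proof.
move=> mA mB AB; apply: EFin_inj.
by rewrite EFinD -!prE//; [rewrite measureU|exact: measurableU].
Qed.

Lemma le_pr A B : measurable A -> measurable B -> A `<=` B -> pr A <= pr B.
Proof. by move=> mA mB AB; rewrite -lee_fin -!prE// le_measure// inE. Qed.

Lemma prD A B : measurable A -> measurable B -> B `<=` A ->
  pr (A `\` B) = pr A - pr B.
Proof.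
move=> mA mB BA; have mD := measurableD mA mB.
rewrite -[in pr A](setDUK BA) prU//; first by rewrite [RHS]addrAC subrr add0r.
by rewrite setDE setICA setICr setI0.
Qed.

End FineProbability.

Section Poissonization.
Context d d' (Om : measurableType d) (T' : measurableType d') (R : realType)
  (P : probability Om R) (mu : probability T' R) (Z : nat -> {RV P >-> T'}).
Hypothesis iidZ : iid_with_law Z mu.
Context (K : eqType) (C : K -> set T').
Hypothesis mC : forall x, measurable (C x).
Hypothesis dC : forall x y, x != y -> C x `&` C y = set0.

Definition hit k w x : bool := `[< exists2 i, (i < k)%N & C x (Z i w) >].

Definition avoid (D : set T') k : set Om := \bigcap_(i < k) (Z i @^-1` (~` D)).

(** Keeping track of a set [D] to be avoided is what lets the next cell be treated by
    inclusion-exclusion. *)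
Definition pattern_event (D : set T') (s : seq K) (A : pred (seq bool)) k : set Om :=
  [set w | avoid D k w /\ A [seq hit k w x | x <- s]].

Lemma measurable_preimage_RV i (A : set T') : measurable A -> measurable (Z i @^-1` A).
Proof. by move=> mA; rewrite -[X in measurable X]setTI; exact: measurable_funP. Qed.

Lemma measurable_avoid D k : measurable D -> measurable (avoid D k).
Proof.
move=> mD; apply: bigcap_measurableType => i _.
by apply: measurable_preimage_RV; exact: measurableC.
Qed.

Lemma pr_avoid D k : measurable D -> pr P (avoid D k) = (1 - pr mu D) ^+ k.
Proof.
move=> mD; case: iidZ => ind law.
pose J := [fset i | i in iota 0 k]%fset.
have mJ i : (i \in J) = (i < k)%N.
  by apply/imfsetP/idP => /= [[j + ->]|ik]; [|exists i => //]; rewrite mem_iota.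
have -> : avoid D k = \bigcap_(i in [set` J]) (Z i @^-1` (~` D)).
  by apply/seteqP; split=> w h i /= ik; apply: h => //=; move: ik; rewrite mJ.
rewrite /pr (ind J (fun=> ~` D)); last by move=> _; exact: measurableC.
have pE i : P (Z i @^-1` (~` D)) = (1 - pr mu D)%:E.
  transitivity (mu (~` D)); first by rewrite -(law i)//; exact: measurableC.
  by rewrite probability_setC// prE.
under eq_bigr do rewrite pE.
have sJ : size J = k.
  rewrite -[RHS](size_iota 0); apply: perm_size.
  by apply: uniq_perm; rewrite ?fset_uniq ?iota_uniq// => i; rewrite mJ mem_iota.
rewrite -[in RHS]sJ; elim: (enum_fset J) => [|i s IH]; first by rewrite big_nil.
rewrite big_cons exprS -IH fineM//.
elim: s {IH} => [|j s IH]; first by rewrite big_nil.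
by rewrite big_cons fin_numM.
Qed.

Definition poissonw (l : R) (k : nat) : R := expR (- l) * exp_coeff l k.

(** The cell [C x] is hit unless it is avoided together with [D]. *)
Lemma pattern_event_cons D x s A k : pattern_event D (x :: s) A k =
  (pattern_event D s (fun p => A (true :: p)) k `\`
     pattern_event (D `|` C x) s (fun p => A (true :: p)) k) `|`
  pattern_event (D `|` C x) s (fun p => A (false :: p)) k.
Proof.
have avU w : avoid (D `|` C x) k w <-> avoid D k w /\ ~~ hit k w x.
  split=> [h|[h hx] i ik [|cx]].
  - split=> [i ik Dz|]; first by apply: (h i ik); left.
    by apply/asboolPn => -[i ik cx]; apply: (h i ik); right.
  - exact: h.
  - by move/asboolPn: hx; apply; exists i.
apply/seteqP; split=> w /=.
  case=> aD /=; case e: (hit k w x) => hA; [left|right].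
    by split; [split|case=> /avU[_]; rewrite e].
  by split => //; apply/avU; rewrite e.
case=> [[[aD hA] n]|[/avU[aD hx] hA]]; (split; first exact: aD); rewrite /=.
  case e: (hit k w x) => //.
  by exfalso; apply: n; split => //; apply/avU; rewrite e.
by rewrite (negbTE hx).
Qed.

Lemma measurable_pattern_event D s A k : measurable D ->
  measurable (pattern_event D s A k).
Proof.
elim: s D A => [|x s IH] D A mD.
  rewrite (_ : pattern_event _ _ _ _ = if A [::] then avoid D k else set0).
    by case: ifP => // _; exact: measurable_avoid.
  by apply/seteqP; split=> w; rewrite /pattern_event /=; case: (A _) => // -[].
rewrite pattern_event_cons.
have mDx : measurable (D `|` C x) by exact: measurableU.
by apply: measurableU; [apply: measurableD|]; exact: IH.
Qed.

Lemma pr_pattern_event_cons D x s A k : measurable D ->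
  pr P (pattern_event D (x :: s) A k) =
  pr P (pattern_event D s (fun p => A (true :: p)) k) -
  pr P (pattern_event (D `|` C x) s (fun p => A (true :: p)) k) +
  pr P (pattern_event (D `|` C x) s (fun p => A (false :: p)) k).
Proof.
move=> mD; have mDx : measurable (D `|` C x) by exact: measurableU.
have sub A' : pattern_event (D `|` C x) s A' k `<=` pattern_event D s A' k.
  by move=> w [h hA]; split=> // i ik Dz; apply: (h i ik); left.
rewrite pattern_event_cons prU; last 3 first.
- by apply: measurableD; exact: measurable_pattern_event.
- exact: measurable_pattern_event.
- apply/seteqP; split=> // w [[[aD hA] n] [aDx hf]]; apply: n; split=> //.
rewrite prD//; exact: measurable_pattern_event.
Qed.

(** Induction on the list of cells: by [pr_pattern_event_cons] an occupied cell is the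
    difference of two events with one cell less, and when no cell is left the
    probability of avoiding [D] is (1 - mu D)^k, whose Poisson average is
    exp (- l mu D). *)
Lemma Poissonization (l : R) D s A : measurable D -> uniq s ->
  (forall x, x \in s -> D `&` C x = set0) ->
  series (fun k => poissonw l k * pr P (pattern_event D s A k)) @ \oo -->
  expR (- (l * pr mu D)) *
    expect (coins [seq 1 - expR (- (l * pr mu (C x))) | x <- s]) (fun p => (A p)%:R).
Proof.
elim: s D A => [|x s IH] D A mD us disj.
  rewrite expect_coins_nil.
  rewrite [X in X @ \oo --> _](_ : _ = fun n => (expR (- l) * (A [::])%:R) *
     series (exp_coeff (l * (1 - pr mu D))) n).
    rewrite [X in _ --> X](_ : _ = (expR (- l) * (A [::])%:R) * expR (l * (1 - pr mu D))).
      apply: cvgMr; exact: is_cvg_series_exp_coeff.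
    rewrite mulrAC -expRD mulrC [RHS]mulrC; congr (_ * expR _); lra.
  apply/funext => n; rewrite /series /= mulr_sumr; apply: eq_bigr => k _.
  rewrite /poissonw -mulrA -[RHS]mulrA; congr (_ * _).
  rewrite (_ : pattern_event _ _ _ _ = if A [::] then avoid D k else set0); last first.
    by apply/seteqP; split=> w; rewrite /pattern_event /=; case: (A _) => // -[].
  case: (A _); last by rewrite pr0 mulr0 mul0r.
  by rewrite mul1r pr_avoid// /exp_coeff /= exprMn mulrAC.
move: us => /= /andP[xs us].
have mDx : measurable (D `|` C x) by exact: measurableU.
have dD y : y \in s -> D `&` C y = set0 by move=> ys; apply: disj; rewrite inE ys orbT.
have dDx y : y \in s -> (D `|` C x) `&` C y = set0.
  move=> ys; rewrite setIUl dD// set0U dC//.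
  by apply: contra xs => /eqP ->.
have h1 := IH _ (fun p => A (true :: p)) mD us dD.
have h2 := IH _ (fun p => A (true :: p)) mDx us dDx.
have h3 := IH _ (fun p => A (false :: p)) mDx us dDx.
have := cvgD (cvgB h1 h2) h3.
have eU : expR (- (l * pr mu (D `|` C x))) =
    expR (- (l * pr mu D)) * expR (- (l * pr mu (C x))).
  by rewrite -expRD -opprD -mulrDr prU//; apply: disj; rewrite inE eqxx.
rewrite [map _ _]/= expect_coins_cons eU.
set E1 := expect _ _; set E2 := expect _ _; set u := expR _; set v := expR _ => h.
rewrite [X in X @ \oo --> _](_ : _ =
  ((series (fun k => poissonw l k * pr P (pattern_event D s (fun p => A (true :: p)) k)) -
  series (fun k => poissonw l k * pr P (pattern_event (D `|` C x) s (fun p => A (true :: p)) k))) +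
  series (fun k => poissonw l k * pr P (pattern_event (D `|` C x) s (fun p => A (false :: p)) k)))).
  have -> : u * ((1 - v) * E1 + (1 - (1 - v)) * E2) = u * E1 - u * v * E1 + u * v * E2 by lra.
  exact: h.
apply/funext => n; rewrite -[RHS]/(series _ n - series _ n + series _ n) /series /=.
rewrite -sumrB -big_split; apply: eq_bigr => k _ /=.
by rewrite pr_pattern_event_cons//; lra.
Qed.

(** Beyond n the weights satisfy (n + 1) w_(k+1) <= l w_k, so they sum to at most
    l / (n + 1). *)
Lemma Poisson_lower_mass (l : R) n : 0 <= l ->
  1 - l / n.+1%:R <= series (poissonw l) n.+1.
Proof.
move=> l0.
have w0 k : 0 <= poissonw l k by rewrite mulr_ge0 ?expR_ge0// exp_coeff_ge0.
have cv : series (poissonw l) @ \oo --> (1 : R).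
  rewrite [X in X @ \oo --> _](_ : _ = fun n => expR (- l) * series (exp_coeff l) n).
    rewrite [X in _ --> X](_ : _ = expR (- l) * expR l).
      by apply: cvgMr; exact: is_cvg_series_exp_coeff.
    by rewrite -expRD addNr expR0.
  by apply/funext => k; rewrite /series /= mulr_sumr.
have nd : nondecreasing_seq (series (poissonw l)).
  by apply/nondecreasing_seqP => k; rewrite seriesSr lerDl.
have le1 k : series (poissonw l) k <= 1.
  have := nondecreasing_cvgn_le nd (cvgP _ cv) k.
  by rewrite (cvg_lim _ cv).
have ratio k : (n.+1%:R) * poissonw l (n.+1 + k)%N <= l * poissonw l (n + k)%N.
  apply: (@le_trans _ _ ((n + k)%N.+1%:R * poissonw l (n + k)%N.+1)).
    by rewrite addSn ler_wpM2r// ler_nat ltnS leq_addr.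
  rewrite /poissonw mulrCA [leRHS]mulrCA ler_pM2l ?expR_gt0//.
  rewrite /exp_coeff /= exprS factS natrM invfM.
  set a := (n + k).+1%:R; set f := ((n + k)`!%:R)^-1; set x := l ^+ (n + k)%N.
  have aa : a * a^-1 = 1 by rewrite divff// pnatr_eq0.
  move: aa; set ai := a^-1 => aa.
  have -> : a * (l * x * (ai * f)) = (a * ai) * (l * (x * f)) by lra.
  by rewrite aa mul1r.
have tail k : n.+1%:R * (series (poissonw l) (n.+1 + k)%N - series (poissonw l) n.+1) <=
    l * (series (poissonw l) (n + k)%N - series (poissonw l) n).
  elim: k => [|k IH]; first by rewrite !addn0 !subrr !mulr0.
  have e1 : series (poissonw l) (n.+1 + k.+1)%N =
      series (poissonw l) (n.+1 + k)%N + poissonw l (n.+1 + k)%N.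
    by rewrite addnS seriesSr.
  have e2 : series (poissonw l) (n + k.+1)%N =
      series (poissonw l) (n + k)%N + poissonw l (n + k)%N.
    by rewrite addnS seriesSr.
  have := ratio k; rewrite e1 e2; lra.
have n0 : 0 < n.+1%:R :> R by [].
have bnd k : series (poissonw l) (n.+1 + k)%N <= series (poissonw l) n.+1 + l / n.+1%:R.
  rewrite -lerBlDl ler_pdivlMr// mulrC; apply: le_trans (tail k) _.
  have s0 : 0 <= series (poissonw l) n by apply: sumr_ge0.
  have := ler_wpM2l l0 (le1 (n + k)%N); have := mulr_ge0 l0 s0; lra.
have : limn (series (poissonw l)) <= series (poissonw l) n.+1 + l / n.+1%:R.
  apply: limr_le; first exact: cvgP cv.
  by exists n.+1 => // k /= nk; have := bnd (k - n.+1)%N; rewrite subnKC.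
by rewrite (cvg_lim _ cv)// lerBlDr.
Qed.

Lemma measurable_pattern s (A : pred (seq bool)) k :
  measurable [set w | A [seq hit k w x | x <- s]].
Proof.
rewrite [X in measurable X](_ : _ = pattern_event set0 s A k).
  exact: measurable_pattern_event.
by apply/seteqP; split=> w; [move=> Aw; split => // i _ []|case].
Qed.

(** A pattern event that survives the removal of points is more likely for k <= n points
    than for n points, so its Poisson average is at least its probability for n points
    times the mass of {0, ..., n}. *)
Lemma depoissonization (l : R) n s (A : pred (seq bool)) : 0 <= l -> uniq s ->
  (forall p p', size p = size p' -> (forall i, nth false p i -> nth false p' i) ->
     A p' -> A p) ->
  pr P [set w | A [seq hit n w x | x <- s]] * (1 - l / n.+1%:R) <=
  expect (coins [seq 1 - expR (- (l * pr mu (C x))) | x <- s]) (fun p => (A p)%:R).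
Proof.
move=> l0 us antiA.
have cv := @Poissonization l set0 s A measurable0 us (fun x _ => set0I (C x)).
rewrite pr0 mulr0 oppr0 expR0 mul1r in cv.
have evE k : pattern_event set0 s A k = [set w | A [seq hit k w x | x <- s]].
  by apply/seteqP; split=> w; [case|move=> Aw; split => // i _ []].
have w0 k : 0 <= poissonw l k by rewrite mulr_ge0 ?expR_ge0// exp_coeff_ge0.
have nd : nondecreasing_seq
    (series (fun k => poissonw l k * pr P (pattern_event set0 s A k))).
  by apply/nondecreasing_seqP => k; rewrite seriesSr lerDl mulr_ge0// pr_ge0.
have := nondecreasing_cvgn_le nd (cvgP _ cv) n.+1; rewrite (cvg_lim _ cv)//.
apply: le_trans; rewrite -evE.
apply: (@le_trans _ _ (pr P (pattern_event set0 s A n) * series (poissonw l) n.+1)).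
  by rewrite ler_wpM2l// ?pr_ge0// Poisson_lower_mass.
rewrite /series /= mulr_sumr; apply: ler_sum_nat => k /andP[_ kn].
rewrite mulrC ler_wpM2l// le_pr//; [exact: measurable_pattern_event..|].
rewrite !evE => w /=; apply: antiA; first by rewrite !size_map.
move=> i; have [si|si] := ltnP i (size s); last by rewrite nth_default// size_map.
have [x0 _] : exists x0 : K, x0 \in s by case: (s) si => // x0 s' _; exists x0; rewrite inE eqxx.
rewrite !(nth_map x0)// => /asboolP[j jk cx]; apply/asboolP; exists j => //.
exact: leq_trans jk _.
Qed.

End Poissonization.

(** * Blocks of cells and their diagonals *)

Lemma lt_cell_trans : transitive lt_cell.
Proof.
move=> y x z /andP[xy1 xy2] /andP[yz1 yz2].
by rewrite /lt_cell (ltn_trans xy1 yz1) (ltn_trans xy2 yz2).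
Qed.

Lemma sorted_cat (T : eqType) (r : rel T) s t : transitive r ->
  sorted r s -> sorted r t -> (forall x y, x \in s -> y \in t -> r x y) ->
  sorted r (s ++ t).
Proof.
move=> tr; rewrite !sorted_pairwise// pairwise_cat => -> -> st; rewrite !andbT.
by apply/allrelP => x y; exact: st.
Qed.

Section Cells.
Local Open Scope nat_scope.
Variables B h L : nat.

(** The block [b = (i, s)] is the one in column [i] and row [i + s] of the grid of
    blocks, that is, the [i]-th block of the [s]-th diagonal. *)
Definition cell_index (b ru : nat * nat) : nat * nat :=
  (b.1 * B + ru.2, (b.1 + b.2) * B + (B - ru.1.+1)).

Definition block_rows (b : nat * nat) : seq (seq (nat * nat)) :=
  [seq [seq cell_index b (r, u) | u <- iota 0 B] | r <- iota 0 B].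

Definition positions : seq (nat * nat) := [seq (r, u) | r <- iota 0 B, u <- iota 0 B].

Definition blocks : seq (nat * nat) := [seq (i, s) | s <- iota 0 h, i <- iota 0 L].

Definition all_cells : seq (nat * nat) :=
  [seq cell_index b ru | b <- blocks, ru <- positions].

Lemma size_blocks : size blocks = h * L.
Proof. by rewrite size_allpairs !size_iota. Qed.

Lemma uniq_all_cells : uniq all_cells.
Proof.
apply: allpairs_uniq.
- by apply: allpairs_uniq; rewrite ?iota_uniq// => -[? ?] [? ?] _ _ /= [-> ->].
- by apply: allpairs_uniq; rewrite ?iota_uniq// => -[? ?] [? ?] _ _ /= [-> ->].
move=> x y /allpairsP[[b ru] [/= _ ruP ->]] /allpairsP[[b' ru'] [/= _ ruP' ->]] /=.
case: b => i s; case: b' => i' s'.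
move: ruP ruP' => /allpairsP[[r u] [/= + + ->]] /allpairsP[[r' u'] [/= + + ->]].
rewrite !mem_iota /= !add0n => rB uB r'B u'B; rewrite /cell_index /= => -[e1 e2].
have dm k v : v < B -> (k * B + v) %/ B = k /\ (k * B + v) %% B = v.
  move=> vB; have B0 : 0 < B by exact: leq_ltn_trans vB.
  by rewrite divnMDl// divn_small// addn0 modnMDl modn_small.
have [q1 m1] := dm i u uB; have [q1' m1'] := dm i' u' u'B.
have [q2 m2] := dm (i + s) (B - r.+1) ltac:(by clear -uB; case: (B) uB => // B' _; rewrite subSS ltnS leq_subr).
have [q2' m2'] := dm (i' + s') (B - r'.+1) ltac:(by clear -u'B; case: (B) u'B => // B' _; rewrite subSS ltnS leq_subr).
have ii : i = i' by rewrite -q1 e1.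
have uu : u = u' by rewrite -m1 e1.
have ss : i + s = i' + s' by rewrite -q2 e2.
have rr : B - r.+1 = B - r'.+1 by rewrite -m2 e2.
have -> : r = r' by move: rr rB r'B; clear; lia.
have -> : s = s' by move: ss ii; clear; lia.
by rewrite ii uu.
Qed.

Lemma all_cells_bound x : x \in all_cells -> x.1 < (L + h) * B /\ x.2 < (L + h) * B.
Proof.
have lt k k' u : k < k' -> u < B -> k * B + u < k' * B.
  move=> kk uB; apply: (@leq_trans (k.+1 * B)); last by rewrite leq_mul2r kk orbT.
  by rewrite mulSn addnC ltn_add2r.
move=> /allpairsP[[b ru] [/= + + ->]].
move=> /allpairsP[[s i] [/= + + ->]] /allpairsP[[r u] [/= + + ->]].
rewrite !mem_iota /= !add0n => sh iL rB uB; split; apply: lt => //.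
- exact: leq_trans iL (leq_addr _ _).
- by rewrite -addSn leq_add// ltnW.
- by case: (B) rB => // B' _; rewrite subSS ltnS leq_subr.
Qed.

Lemma reshape_flatten N k (ss : seq (seq bool)) : size ss = N ->
  all (fun w => size w == k) ss -> reshape (nseq N k) (flatten ss) = ss.
Proof.
move=> <- ak; have -> : nseq (size ss) k = shape ss; last exact: flattenK.
by elim: ss ak => //= w ss IH /andP[/eqP -> /IH ->].
Qed.

Lemma blocksum_cells (f : nat * nat -> bool) :
  blocksum B (h * L) (map f all_cells) =
  (\sum_(b <- blocks) lis (map (map f) (block_rows b)) B)%N.
Proof.
rewrite /blocksum /all_cells map_allpairs.
rewrite reshape_flatten; last 2 first.
- by rewrite size_map size_blocks.
- by apply/allP => w /mapP[b _ ->]; rewrite size_map size_allpairs !size_iota.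
rewrite big_map; apply: eq_bigr => b _; congr (lis _ B).
rewrite /grid /positions map_allpairs reshape_flatten//.
- by rewrite /block_rows -map_comp; apply: eq_map => r /=; rewrite -map_comp.
- by rewrite size_map size_iota.
- by apply/allP => w /mapP[r _ ->]; rewrite size_map size_iota.
Qed.

Lemma block_chain (f : nat * nat -> bool) b : exists c : seq (nat * nat),
  [/\ size c = lis (map (map f) (block_rows b)) B, sorted lt_cell c &
   all (fun x => [&& f x, b.1 * B <= x.1 < b.1.+1 * B &
     (b.1 + b.2) * B <= x.2 < (b.1 + b.2).+1 * B]) c].
Proof.
have [c [sc pc ac]] := lis_chain (map (map f) (block_rows b)) B.
exists [seq (b.1 * B + x.1, (b.1 + b.2) * B + x.2) | x <- c]; split.
- by rewrite size_map.
- rewrite sorted_map; apply: sub_sorted pc => x y /andP[xy1 xy2].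
  by rewrite /lt_cell /= !ltn_add2l xy1.
rewrite all_map; apply: sub_all ac => x /=; rewrite !size_map size_iota.
move=> /and3P[x1 x2 fx]; apply/and3P; split; last 2 first.
- by rewrite leq_addr mulSn addnC ltn_add2r.
- by rewrite leq_addr mulSn addnC ltn_add2r.
move: fx; rewrite (nth_map [::]); last by rewrite size_map size_iota; move: x2; clear; lia.
have h1 : B - x.2.+1 < B by move: x2; clear; lia.
rewrite (nth_map 0) ?size_iota// (nth_map (0, 0)); last by rewrite size_map size_iota.
rewrite (nth_map 0) ?size_iota// !nth_iota// !add0n /cell_index /=.
by have -> : B - (B - x.2.+1).+1 = x.2 by move: x2; clear; lia.
Qed.

(** The blocks of a diagonal are increasing, so their longest chains concatenate. *)
Lemma diagonal_chain (f : nat * nat -> bool) s : exists c : seq (nat * nat),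
  [/\ size c = (\sum_(i <- iota 0 L) lis (map (map f) (block_rows (i, s))) B)%N,
   sorted lt_cell c & all (fun x => [&& f x, x.1 < L * B & x.2 < (L + s) * B]) c].
Proof.
elim: L => [|L' [c [sc pc ac]]]; first by exists [::]; rewrite big_nil.
have [c' [sc' pc' ac']] := block_chain f (L', s).
exists (c ++ c'); split.
- by rewrite size_cat -addn1 iotaD big_cat /= big_seq1 sc sc' add0n.
- apply: (sorted_cat lt_cell_trans) => // x y xc yc.
  have /allP/(_ x xc)/and3P[_ x1 x2] := ac.
  have /allP/(_ y yc)/and3P[_ /andP[y1 _] /andP[y2 _]] := ac'.
  by rewrite /lt_cell (leq_trans x1 y1) (leq_trans x2 y2).
- rewrite all_cat; apply/andP; split.
    apply: sub_all ac => x /and3P[-> x1 x2] /=.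
    by rewrite (leq_trans x1) ?(leq_trans x2)// leq_mul2r ?leq_add2r leqnSn orbT.
  apply: sub_all ac' => x /and3P[-> /andP[_ x1] /andP[_ x2]] /=.
  by rewrite x1 addSn x2.
Qed.

Lemma some_diagonal_chain (R : realType) (f : nat * nat -> bool) (v : R) :
  (v * h%:R < (blocksum B (h * L) (map f all_cells))%:R)%R ->
  exists c : seq (nat * nat),
    [/\ (v < (size c)%:R)%R, sorted lt_cell c &
     all (fun x => [&& f x, x.1 < (L + h) * B & x.2 < (L + h) * B]) c].
Proof.
rewrite blocksum_cells /blocks big_allpairs_dep => hv.
have [s sh vs] : exists2 s, s < h &
    (v < (\sum_(i <- iota 0 L) lis (map (map f) (block_rows (i, s))) B)%N%:R)%R.
  apply: contrapT => no; move: hv; apply/negP; rewrite -leNgt.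
  rewrite natr_sum (_ : v * _ = \sum_(s <- iota 0 h) v)%R; last first.
    by rewrite big_const_seq count_predT size_iota iter_addr_0 mulr_natr.
  rewrite big_seq [leRHS]big_seq; apply: ler_sum => s; rewrite mem_iota /= add0n => sh.
  by rewrite leNgt; apply/negP => vs; apply: no; exists s.
have [c [sc pc ac]] := diagonal_chain f s.
exists c; split; rewrite ?sc//.
apply: sub_all ac => x /and3P[-> x1 x2] /=; apply/andP; split.
  by apply: leq_trans x1 _; rewrite leq_mul2r leq_addr orbT.
by apply: leq_trans x2 _; rewrite leq_mul2r leq_add2l (ltnW sh) orbT.
Qed.

End Cells.

(** * Cells in the plane and chains of sample points *)

Section IntegralMonotone.
Context d (T : measurableType d) (R : realType) (mu : {measure set T -> \bar R}).
Local Open Scope ereal_scope.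

(** The integral of a nonnegative function is a supremum over simple functions below it,
    so monotonicity needs no measurability. *)
Lemma ge0_le_integralW (D : set T) (f g : T -> \bar R) :
  (forall x, D x -> 0 <= f x) -> (forall x, D x -> f x <= g x) ->
  \int[mu]_(x in D) f x <= \int[mu]_(x in D) g x.
Proof.
move=> f0 fg.
have g0 x : D x -> 0 <= g x by move=> Dx; exact: le_trans (f0 x Dx) (fg x Dx).
rewrite !ge0_integralE//; apply: le_ereal_sup => _ [h hf <-]; exists h => // x.
apply: le_trans (hf x) _; rewrite /patch; case: ifPn => //.
by rewrite inE; exact: fg.
Qed.

End IntegralMonotone.

Section Cell.
Context {R : realType}.
Variables (x0 y0 wx wy : R).
Hypotheses (wx0 : 0 < wx) (wy0 : 0 < wy).

Definition cell (k : nat * nat) : set (R * R) :=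
  `]x0 + k.1%:R * wx, x0 + k.1.+1%:R * wx] `*` `]y0 + k.2%:R * wy, y0 + k.2.+1%:R * wy].

Lemma cell_step_disjoint (x w t : R) (i j : nat) : 0 < w -> (i < j)%N ->
  t <= x + i.+1%:R * w -> x + j%:R * w < t -> False.
Proof.
move=> w0 ij h1 h2; have : i.+1%:R <= j%:R :> R by rewrite ler_nat.
move/(ler_wpM2r (ltW w0)) => h; lra.
Qed.

Lemma cell_disjoint k k' : k != k' -> cell k `&` cell k' = set0.
Proof.
case: k k' => i j [i' j']; rewrite xpair_eqE negb_and !neq_ltn => h.
apply/seteqP; split=> // -[a b] [[/= + +] [/= + +]]; rewrite !in_itv /=.
move=> /andP[a1 a2] /andP[b1 b2] /andP[a1' a2'] /andP[b1' b2'].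
case/orP: h => /orP[]h.
- exact: (cell_step_disjoint wx0 h a2 a1').
- exact: (cell_step_disjoint wx0 h a2' a1).
- exact: (cell_step_disjoint wy0 h b2 b1').
- exact: (cell_step_disjoint wy0 h b2' b1).
Qed.

Lemma cell_lt k k' z z' : lt_cell k k' -> cell k z -> cell k' z' ->
  (z.1 < z'.1) && (z.2 < z'.2).
Proof.
case: z z' => a b [a' b'] /andP[k1 k2] [/= + +] [/= + +]; rewrite !in_itv /=.
move=> /andP[_ a2] /andP[_ b2] /andP[a1 _] /andP[b1 _].
have h1 : k.1.+1%:R <= k'.1%:R :> R by rewrite ler_nat.
have h2 : k.2.+1%:R <= k'.2%:R :> R by rewrite ler_nat.
have := ler_wpM2r (ltW wx0) h1; have := ler_wpM2r (ltW wy0) h2 => g1 g2.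
by apply/andP; split; lra.
Qed.

Lemma measurable_cell k : measurable (cell k : set (plane R)).
Proof. by apply: measurableX; exact: measurable_itv. Qed.

Lemma lebesgue_cell k :
  ((@lebesgue_measure R) \x (@lebesgue_measure R))%E (cell k : set (plane R)) = (wx * wy)%:E.
Proof.
have itvE (x w : R) i : 0 < w ->
    @lebesgue_measure R `]x + i%:R * w, x + i.+1%:R * w]%classic = w%:E.
  move=> w0; rewrite lebesgue_measure_itv /= lte_fin ltrD2l ltr_pM2r// ltr_nat leqnn.
  by rewrite -EFinD -natr1; congr (_%:E); lra.
rewrite /cell product_measure1E; [|exact: measurable_itv..].
by rewrite EFinM -(itvE x0 wx k.1)// -(itvE y0 wy k.2).
Qed.

Lemma cell_sub (M : nat) k : (k.1 < M)%N -> (k.2 < M)%N ->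
  cell k `<=` `]x0, x0 + M%:R * wx] `*` `]y0, y0 + M%:R * wy].
Proof.
move=> k1 k2 [a b] [/= + +]; rewrite !in_itv /= => /andP[a1 a2] /andP[b1 b2].
have h1 : k.1.+1%:R <= M%:R :> R by rewrite ler_nat.
have h2 : k.2.+1%:R <= M%:R :> R by rewrite ler_nat.
have := ler_wpM2r (ltW wx0) h1; have := ler_wpM2r (ltW wy0) h2 => g1 g2.
have : 0 <= k.1%:R * wx by rewrite mulr_ge0// ltW.
have : 0 <= k.2%:R * wy by rewrite mulr_ge0// ltW.
move=> e1 e2.
have i1 : a \in `]x0, x0 + M%:R * wx] by rewrite in_itv /=; apply/andP; split; lra.
have i2 : b \in `]y0, y0 + M%:R * wy] by rewrite in_itv /=; apply/andP; split; lra.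
by split.
Qed.

Lemma cell_mass (mu : probability (plane R) R) (p : R * R -> R) (m : R) k :
  has_density_on_unit_square mu p -> 0 <= m -> cell k `<=` @unit_square R ->
  (forall z, cell k z -> m <= p z) -> m * (wx * wy) <= pr mu (cell k : set (plane R)).
Proof.
move=> dens m0 sub pm; have mc := measurable_cell k.
have subE : cell k `&` @unit_square R = cell k by apply/setIidPl.
rewrite -lee_fin -prE// dens// subE.
rewrite EFinM -(lebesgue_cell k) -integral_cst//.
by apply: ge0_le_integralW => z cz; rewrite lee_fin//; exact: pm.
Qed.

End Cell.

Section Chains.
Context {R : realType}.

Definition below (n : nat) (z : nat -> R * R) : rel 'I_n :=
  [rel i j : 'I_n | ((z i).1 < (z j).1) && ((z i).2 < (z j).2)].

Lemma below_trans n z : transitive (@below n z).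
Proof.
move=> j i k /andP[a b] /andP[a' b'].
by rewrite /below /= (lt_trans a a') (lt_trans b b').
Qed.

Definition has_chain (n : nat) (z : nat -> R * R) (D : set (R * R)) (v : R) : Prop :=
  exists t : seq 'I_n,
    [/\ v <= (size t)%:R, sorted (below z) t & forall i, i \in t -> D (z i)].

Lemma chain_longest n z D v : has_chain n z D v -> v <= (longest_increasing n z)%:R.
Proof.
case=> t [vt st _]; apply: le_trans vt _; rewrite ler_nat.
have ut : uniq t.
  apply: (sorted_uniq (@below_trans n z)) st => i.
  by rewrite /below /= ltxx.
have tn : (size t < n.+1)%N by have := max_card (mem t); rewrite card_ord (card_uniqP ut).
rewrite /longest_increasing.
apply: (@leq_bigmax_cond _ _ (fun l : 'I_n.+1 => l : nat) (Ordinal tn)) => /=.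
by apply/existsP; exists (in_tuple t).
Qed.

(** Choosing one sample point in each cell of a chain of hit cells gives an increasing
    chain of points. *)
Lemma cells_chain (x0 y0 wx wy : R) n (z : nat -> R * R) (D : set (R * R))
    (c : seq (nat * nat)) (v : R) : 0 < wx -> 0 < wy ->
  sorted lt_cell c -> v <= (size c)%:R ->
  (forall k, k \in c -> cell x0 y0 wx wy k `<=` D) ->
  (forall k, k \in c -> exists2 i, (i < n)%N & cell x0 y0 wx wy k (z i)) ->
  has_chain n z D v.
Proof.
move=> wx0 wy0 sc vc cD hit.
case: n hit => [|n] hit.
  case: c {sc} vc cD hit => [|k c] vc cD hit; first by exists [::].
  by have [] := hit k (mem_head _ _).
pose f k : 'I_n.+1 := odflt ord0 [pick i : 'I_n.+1 | `[< cell x0 y0 wx wy k (z i) >]].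
have fP k : k \in c -> cell x0 y0 wx wy k (z (f k)).
  move=> /hit[i i_n ci]; rewrite /f; case: pickP => [j /asboolP//|/(_ (Ordinal i_n))].
  by move/asboolP.
exists (map f c); split; first by rewrite size_map.
- have h : {in c &, {homo f : k k' / lt_cell k k' >-> below z k k'}}.
    by move=> k k' kc kc' kk; exact: (cell_lt wx0 wy0 kk (fP _ kc) (fP _ kc')).
  by apply: (homo_sorted_in h _ sc); apply/allP.
- move=> i /mapP[k kc ->]; exact: (cD k kc _ (fP k kc)).
Qed.

End Chains.

(** * Lower tail in a rectangle *)

Lemma eventually_le_sqrt (R : realType) (S : R) :
  exists N0, forall n, (N0 <= n)%N -> S <= Num.sqrt n%:R.
Proof.
exists (Num.truncn (S ^+ 2)).+1 => n hn.
apply: le_trans (ler_norm S) _; rewrite -sqrtr_sqr ler_wsqrtr//.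
by apply: le_trans (ltW (truncnS_gt _)) _; rewrite ler_nat.
Qed.

(** The loss over the limit constant 2: the factor a0 against e, the missing corner blocks
    D / (1 + D), and the slack (1 - e)^2 in the cell size, at most 11 e in total. *)
Lemma mean_constant (R : realFieldType) (e a0 b D Y g : R) :
  0 < e -> e <= 12^-1 -> 0 < Y -> 0 < D -> 1 <= e * D -> a0 * (1 + e) = e ->
  e * ((1 + D) * b) * g = (1 - e) ^+ 2 * Y ->
  (2 - 11 * e) * Y <= (2 - 3 * e) * a0 * b * D * g.
Proof.
move=> e0 e12 Y0 D0 De a0E gE.
have W0 : 0 < (1 + e) * (1 + D) by rewrite mulr_gt0//; lra.
rewrite -(ler_pM2r W0).
have -> : (2 - 3 * e) * a0 * b * D * g * ((1 + e) * (1 + D)) =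
    (2 - 3 * e) * D * (a0 * (1 + e) * ((1 + D) * b) * g) by lra.
rewrite a0E gE.
have h1 : 0 <= (2 - 11 * e) * Y * (1 + e) by rewrite !mulr_ge0 ?ltW//; lra.
have := ler_wpM2l h1 De.
have h2 : 0 <= Y * D * (28 * e ^+ 2 + 8 * e ^+ 3).
  by rewrite mulr_ge0 ?mulr_ge0 ?ltW// addr_gt0// mulr_gt0// exprn_gt0.
lra.
Qed.

(** The mean number of Poisson points in a cell is at least q / (1 - q) for q = e^2. *)
Lemma cell_constant (R : realFieldType) (e M m Y sn wx wy n A : R) :
  0 < e -> e < 1 -> 0 < M -> 0 < m * A -> 0 < sn -> 0 < Y -> Y ^+ 2 = m * A ->
  sn ^+ 2 = n -> (M * wx) * (M * wy) = A -> e * M <= (1 - e) ^+ 2 * Y * sn ->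
  e ^+ 2 <= (1 - e ^+ 2) * ((1 - e) * n * (m * (wx * wy))).
Proof.
move=> e0 e1 M0 mA0 sn0 Y0 Y2 sn2 AE eM.
have eM2 : (e * M) ^+ 2 <= (1 - e) ^+ 4 * (m * A) * n.
  have -> : (1 - e) ^+ 4 * (m * A) * n = ((1 - e) ^+ 2 * Y * sn) ^+ 2.
    by rewrite -Y2 -sn2; lra.
  rewrite lerXn2r// nnegrE; first by rewrite mulr_ge0 ?ltW.
  by rewrite !mulr_ge0 ?exprn_ge0 ?ltW// subr_gt0.
have mAn : 0 <= m * A * n by rewrite mulr_ge0 -?sn2 ?exprn_ge0// ltW.
have e4 : (1 - e) ^+ 4 * (m * A * n) <= (1 - e) * (1 - e ^+ 2) * (m * A * n).
  apply: ler_wpM2r => //.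
  have : 0 <= (1 - e) ^+ 2 * (e * (3 - e)).
    by rewrite mulr_ge0 ?exprn_ge0 ?mulr_ge0//; lra.
  by lra.
have M2 : 0 < M ^+ 2 by rewrite exprn_gt0.
rewrite -(ler_pM2r M2).
have -> : (1 - e ^+ 2) * ((1 - e) * n * (m * (wx * wy))) * M ^+ 2 =
   (1 - e ^+ 2) * ((1 - e) * n * (m * ((M * wx) * (M * wy)))) by lra.
rewrite AE; move: eM2 e4; rewrite exprMn; lra.
Qed.

Section Rectangle.
Context (R : realType) (d : measure_display)
    (Omega : measurableType d) (P : probability Omega R)
    (mu : probability (plane R) R) (p : R * R -> R)
    (Z : nat -> {RV P >-> plane R}).
Hypothesis dens : has_density_on_unit_square mu p.
Hypothesis iidZ : iid_with_law Z mu.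

Definition box (x0 x1 y0 y1 : R) : set (R * R) := `]x0, x1] `*` `]y0, y1].

Lemma box_sub_unit x0 x1 y0 y1 : 0 <= x0 -> x1 <= 1 -> 0 <= y0 -> y1 <= 1 ->
  box x0 x1 y0 y1 `<=` @unit_square R.
Proof.
move=> x00 x11 y00 y11 [a b] [/= + +]; rewrite !in_itv /= => /andP[? ?] /andP[? ?].
have i1 : a \in `[0, 1] by rewrite in_itv /=; apply/andP; split; lra.
have i2 : b \in `[0, 1] by rewrite in_itv /=; apply/andP; split; lra.
by split.
Qed.

(** The rectangle is cut into M x M cells with M a small multiple of sqrt n, so that each
    cell is occupied with probability at least q = e^2 when the sample is Poisson of
    mean (1 - e) n. *)
Lemma rectangle_tail (x0 x1 y0 y1 m e : R) :
  0 <= x0 -> x0 < x1 -> x1 <= 1 -> 0 <= y0 -> y0 < y1 -> y1 <= 1 -> 0 < m ->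
  (forall z, box x0 x1 y0 y1 z -> m <= p z) -> 0 < e -> e <= 12^-1 ->
  exists kappa C : R, exists N0, [/\ 0 < kappa, 0 < C &
    forall n, (N0 <= n)%N -> exists G : set Omega,
    [/\ measurable G, pr P G <= C * expR (- (kappa * n%:R)) &
    forall w, ~ G w -> has_chain n (fun i => Z i w : R * R) (box x0 x1 y0 y1)
       ((2 - 12 * e) * (Num.sqrt (m * ((x1 - x0) * (y1 - y0))) * Num.sqrt n%:R))]].
Proof.
move=> x00 x01 x11 y00 y01 y11 m0 pm e0 e12.
have e1 : e < 1 by lra.
have [||B B0 hB] := @expect_lis R e e; [by rewrite e0 e1..|].
set q := e ^+ 2 in hB; set a0 := e / (1 + e) in hB.
have a00 : 0 < a0 by rewrite divr_gt0//; lra.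
have a0E : a0 * (1 + e) = e by rewrite divfK// gt_eqF//; lra.
have qE : q = e ^+ 2 by [].
have q01 : 0 <= q <= 1 by apply/andP; split; [exact: sqr_ge0|rewrite /q expr_le1// ltW].
clearbody a0 q.
have BR0 : 0 < B%:R :> R by rewrite ltr0n.
have de0 : 0 < e * a0 * B%:R by rewrite !mulr_gt0.
have [k0 k00 tail] := blocksum_tail q01 B0 de0 hB.
(* Diagonals have D' h blocks and there are h of them, in a grid of (D' + 1) h blocks
     per side; the loss D' / (D' + 1) is at most a factor 1 - e. *)
pose D' := (Num.truncn (e^-1)).+1.
have D'e : 1 <= e * D'%:R.
  have := ler_wpM2l (ltW e0) (ltW (truncnS_gt e^-1)); by rewrite divff// lt0r_neq0.
have D'0 : 0 < D'%:R :> R by rewrite ltr0n.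
set A := (x1 - x0) * (y1 - y0); set Y := Num.sqrt (m * A).
have mA0 : 0 < m * A by rewrite !mulr_gt0// subr_gt0.
have Y0 : 0 < Y by rewrite sqrtr_gt0.
have Y2 : Y ^+ 2 = m * A by rewrite sqr_sqrtr// ltW.
pose DB := (D'.+1 * B)%:R : R.
have DB0 : 0 < DB by rewrite ltr0n muln_gt0.
have DBE : DB = (1 + D'%:R) * B%:R by rewrite /DB natrM -nat1r.
(* The number h of diagonals is the integer part of g sqrt n. *)
pose g := (1 - e) ^+ 2 / (e * DB) * Y.
have eDB : 0 < e * DB by rewrite mulr_gt0.
have g0 : 0 < g by rewrite mulr_gt0// divr_gt0// exprn_gt0// subr_gt0.
have gE : e * ((1 + D'%:R) * B%:R) * g = (1 - e) ^+ 2 * Y.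
  by rewrite -DBE /g mulrA [e * DB * _]mulrC divfK// gt_eqF.
pose K1 := (2 - 3 * e) * a0 * B%:R * D'%:R.
have K1E : K1 = (2 - 3 * e) * a0 * B%:R * D'%:R by [].
have K10 : 0 < K1 by rewrite !mulr_gt0//; lra.
have K1g : (2 - 11 * e) * Y <= K1 * g.
  by rewrite K1E; apply: mean_constant gE => //; rewrite ?DBE.
clearbody g K1.
have [N1 hN1] := eventually_le_sqrt (2 / g).
have [N2 hN2] := eventually_le_sqrt (K1 / (e * Y)).
exists (k0 * D'%:R * g ^+ 2 / 4), e^-1, (maxn N1 N2).+1; split.
- by rewrite divr_gt0// !mulr_gt0// exprn_gt0.
- by rewrite invr_gt0.
move=> n; rewrite gtn_max => /andP[nN1 nN2].
have n0 : (0 < n)%N by exact: leq_ltn_trans nN1.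
set sn := Num.sqrt n%:R.
have sn0 : 0 < sn by rewrite sqrtr_gt0 ltr0n.
have sn2 : sn ^+ 2 = n%:R by rewrite sqr_sqrtr// ltW// ltr0n.
have sng : 2 <= sn * g by rewrite -ler_pdivrMr// hN1// ltnW.
have snK : K1 <= sn * (e * Y) by rewrite -ler_pdivrMr ?mulr_gt0// hN2// ltnW.
pose h := Num.truncn (sn * g).
have hle : h%:R <= sn * g by rewrite truncn_le; lra.
have hge : sn * g < h%:R + 1 by rewrite natr1 truncnS_gt.
have h0 : (0 < h)%N by rewrite -(ltr_nat R); lra.
have hR0 : 0 < h%:R :> R by rewrite ltr0n.
pose L := (D' * h)%N; pose M := ((L + h) * B)%N.
have ME : M%:R = DB * h%:R.
  by rewrite /M /L /DB -mulSnr mulnAC natrM.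
have M0 : 0 < M%:R :> R by rewrite ME mulr_gt0.
pose wx := (x1 - x0) / M%:R; pose wy := (y1 - y0) / M%:R.
have wx0 : 0 < wx by rewrite divr_gt0// subr_gt0.
have wy0 : 0 < wy by rewrite divr_gt0// subr_gt0.
have wxE : M%:R * wx = x1 - x0 by rewrite mulrC divfK// gt_eqF.
have wyE : M%:R * wy = y1 - y0 by rewrite mulrC divfK// gt_eqF.
pose C := cell x0 y0 wx wy.
have boxE : box x0 x1 y0 y1 = `]x0, x0 + M%:R * wx] `*` `]y0, y0 + M%:R * wy].
  have -> : x0 + M%:R * wx = x1 by rewrite wxE addrC subrK.
  by have -> : y0 + M%:R * wy = y1 by rewrite wyE addrC subrK.
have Csub k : (k.1 < M)%N -> (k.2 < M)%N -> C k `<=` box x0 x1 y0 y1.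
  by move=> ? ?; rewrite boxE; exact: cell_sub.
have box1 := box_sub_unit x00 x11 y00 y11.
pose s := all_cells B h L.
pose l : R := (1 - e) * n%:R.
have l0 : 0 <= l by rewrite mulr_ge0// subr_ge0 ltW.
pose qs := [seq 1 - expR (- (l * pr mu (C x))) | x <- s].
have qs_ok : all (fun q' => q <= q' <= 1) qs.
  apply/allP => _ /mapP[k ks ->]; have [k1 k2] := all_cells_bound ks.
  have mass : m * (wx * wy) <= pr mu (C k).
    apply: (cell_mass wx0 wy0 dens (ltW m0)).
      by apply: subset_trans box1; exact: Csub.
    by move=> z cz; apply: pm; exact: Csub cz.
  have y0' : 0 <= l * pr mu (C k) by rewrite mulr_ge0// pr_ge0.
  apply/andP; split; last by rewrite gerBl expR_ge0.
  rewrite lerBrDr addrC -lerBrDr expRN -[leLHS]mul1r ler_pdivrMr ?expR_gt0//.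
  have q1 : 0 < 1 - q by rewrite qE subr_gt0 expr_lt1// ltW.
  apply: le_trans (ler_wpM2l (ltW q1) (expR_ge1Dx _)).
  have yE : l * (m * (wx * wy)) <= l * pr mu (C k) by exact: ler_wpM2l.
  have key : q <= (1 - q) * (l * (m * (wx * wy))).
    rewrite qE; apply: (@cell_constant R e M%:R m Y sn wx wy n%:R A) => //.
    - by rewrite wxE wyE.
    - rewrite -gE -DBE ME mulrA -[leRHS]mulrA ler_pM2l// [g * sn]mulrC; exact: hle.
  by rewrite mulrDr mulr1 -[leLHS](subrK q) lerD2l (le_trans key)// ler_wpM2l// ltW.
have sqs : size qs = (h * L * (B * B))%N.
  by rewrite size_map size_allpairs size_blocks size_allpairs !size_iota.
pose v : R := (2 - 2 * e) * a0 * B%:R - e * a0 * B%:R.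
pose bad (pat : seq bool) : bool := ((blocksum B (h * L) pat)%:R <= v * (h * L)%:R)%R.
have depo := @depoissonization _ _ _ _ _ P mu Z iidZ _ C
  (fun k => measurable_cell x0 y0 wx wy k) (fun k k' kk => cell_disjoint x0 y0 wx0 wy0 kk)
  l n s bad l0 (uniq_all_cells B h L).
exists [set w | bad [seq hit Z C n w x | x <- s]]; split.
- by apply: measurable_pattern => // k; exact: measurable_cell.
- have Ge : pr P [set w | bad [seq hit Z C n w x | x <- s]] * e <=
      expR (- (k0 * (h * L)%:R)).
    apply: le_trans (tail _ _ sqs qs_ok).
    apply: le_trans (depo _); last first.
      by move=> pa pa' spa hpa; apply: le_trans; rewrite ler_nat blocksum_mono.
    apply: ler_wpM2l; first exact: pr_ge0.
    have nS : 0 < n.+1%:R :> R by rewrite ltr0n.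
    have : l / n.+1%:R <= 1 - e; last by rewrite lerBrDr lerBrDl.
    by rewrite ler_pdivrMr// /l ler_wpM2l ?ler_nat ?leqnSn// subr_ge0 ltW.
  rewrite mulrC ler_pdivlMr//; apply: le_trans Ge _; rewrite ler_expR lerN2.
  have -> : (h * L)%:R = D'%:R * h%:R ^+ 2 :> R by rewrite !natrM; lra.
  have hh : (sn * g) ^+ 2 / 4 <= h%:R ^+ 2.
    have -> : (sn * g) ^+ 2 / 4 = (sn * g / 2) ^+ 2 by lra.
    by rewrite lerXn2r// ?nnegrE//; lra.
  have kD : 0 <= k0 * D'%:R by rewrite mulr_ge0// ltW.
  have := ler_wpM2l kD hh; rewrite -sn2; lra.
- move=> w /negP; rewrite -ltNge => nb.
  have [|c [cv cs /allP ac]] := @some_diagonal_chain B h L R (hit Z C n w) (v * L%:R).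
    by rewrite -mulrA -natrM mulnC.
  apply: (@cells_chain R x0 y0 wx wy n _ _ c) => //.
  + apply: le_trans (ltW cv); rewrite /v /L natrM.
    have h1 : K1 * (sn * g - 1) <= K1 * h%:R by apply: ler_wpM2l; [exact: ltW|lra].
    have h2 := ler_wpM2r (ltW sn0) K1g.
    rewrite -/A -/Y -/sn; move: h1; rewrite {2}K1E; lra.
  + by move=> k /ac /and3P[_ k1 k2]; exact: Csub.
  + by move=> k /ac /and3P[/asboolP].
Qed.

End Rectangle.

(** * Absolutely continuous monotone functions are integrals of their derivatives *)

Section Density.
Context {R : realType} (phi : R -> R).
Hypothesis phiB : Bup phi.
Notation lam := (@lebesgue_measure R).

Definition clip (x : R) : R := Num.max 0 (Num.min x 1).

Lemma clip01 x : 0 <= clip x <= 1.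
Proof. by rewrite /clip le_max lexx /= ge_max ler01 ge_min lexx orbT. Qed.

Lemma clip_id x : 0 <= x <= 1 -> clip x = x.
Proof. by move=> /andP[x0 x1]; rewrite /clip min_l// max_r. Qed.

Lemma clip_nd x y : x <= y -> clip x <= clip y.
Proof.
move=> xy; have h : Num.min x 1 <= Num.min y 1 by rewrite le_min !ge_min xy lexx orbT.
by rewrite /clip ge_max !le_max lexx h orbT.
Qed.

Lemma clipE x : clip x = if x < 0 then 0 else if x < 1 then x else 1.
Proof.
rewrite /clip; case: (ltP x 1) => x1; first by case: (ltP x 0).
by rewrite max_r// ltNge (le_trans ler01).
Qed.

Lemma clip_lip x y : x <= y -> clip y - clip x <= y - x.
Proof.
move=> xy; rewrite !clipE.
case: (ltP y 0) => ?; case: (ltP x 0) => ?; case: (ltP y 1) => ?; case: (ltP x 1) => ?; lra.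
Qed.

Definition clipped (x : R) : R := phi (clip x).

Lemma clipped_nd : nondecreasing clipped.
Proof.
case: phiB => nd _ _ x y xy; apply: nd; rewrite ?in_itv ?clip01//.
exact: clip_nd.
Qed.

Lemma clipped_continuous : continuous clipped.
Proof.
case: phiB => nd ac _ x.
apply/(@cvgrPdist_lt _ R^o) => e e0; have [del del0 hd] := ac e e0.
near=> y.
have xy : `|x - y| < del.
  by near: y; apply: cvgr_dist_lt => //; exact: cvg_id.
have main u v : u <= v -> v - u < del -> `|clipped v - clipped u| < e.
  move=> uv vu; have := hd 1%N (fun=> clip u) (fun=> clip v).
  rewrite !big_ord1; apply.
  - move=> i _; have /andP[u0 _] := clip01 u; have /andP[_ v1] := clip01 v.
    by split => //; split => //; exact: clip_nd.
  - by move=> i j /= ; rewrite /= !ltnS !leqn0 => /eqP -> /eqP ->.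
  - exact: le_lt_trans (clip_lip uv) vu.
have [le|le] := leP x y.
  rewrite distrC; apply: main => //; apply: le_lt_trans xy.
  by rewrite distrC ler_norm.
apply: main; first exact: ltW.
by apply: le_lt_trans xy; exact: ler_norm.
Unshelve. all: by end_near. Qed.

Definition cumul : cumulative R R :=
  HB.pack clipped (isCumulative.Build R _ R clipped clipped_nd
    (right_continuousW clipped_continuous)).

Definition stieltjes : {measure set (measurableTypeR R) -> \bar R} := lebesgue_stieltjes_measure cumul.

Lemma stieltjesE a b : a <= b -> stieltjes `]a, b]%classic = (clipped b - clipped a)%:E.
Proof.
move=> ab; rewrite /stieltjes /= /lebesgue_stieltjes_measure /measure_extension.
by rewrite measurable_mu_extE/= ?wlength_itv_bnd//; exact: is_ocitv.
Qed.

Let D : set (measurableTypeR R) := `]0, 1[%classic.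
Let mD : measurable D. Proof. exact: measurable_itv. Qed.

Lemma stieltjes_finite : (stieltjes D < +oo)%E.
Proof.
apply: (@le_lt_trans _ _ (stieltjes `]0, 1]%classic)); last by rewrite stieltjesE// ltry.
apply: le_measure; rewrite ?inE; [exact: mD|exact: measurable_itv|].
by move=> x; rewrite /D /= !in_itv /= => /andP[-> /ltW].
Qed.

Definition stieltjes01 : {finite_measure set (measurableTypeR R) -> \bar R} := mfrestr mD stieltjes_finite.

Lemma stieltjes01E A : stieltjes01 A = stieltjes (A `&` D). Proof. by []. Qed.

(** The part of a null set in ]0, 1[ is covered by an open subset of ]0, 1[ of small
    length, which is a disjoint union of intervals; absolute continuity bounds the
    increments over finitely many of
    them. *)
Lemma stieltjes01_dominated : stieltjes01 `<< lam.
Proof.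
apply/null_content_dominatesP => A mA A0; rewrite stieltjes01E.
case: phiB => nd ac _.
apply/eqP; rewrite eq_le measure_ge0 andbT; apply/lee_addgt0Pr => e e0.
rewrite add0e; have [del del0 hd] := ac e e0.
have [|||U [oU AU lU]] := @lebesgue_regularity_outer R A del => //.
  by rewrite A0.
pose V := U `&` `]0, 1[%classic.
have oV : open V by apply: openI => //; exact: interval_open.
have mU : measurable (U : set (measurableTypeR R)).
  exact: measurable_realfun.open_measurable.
have mV : measurable (V : set (measurableTypeR R)).
  exact: measurable_realfun.open_measurable.
have lV : (lam V < del%:E)%E.
  apply: le_lt_trans lU.
  apply: (@le_trans _ _ (lam ((U `\` A) `|` A))).
    apply: le_measure; rewrite ?inE//.
      by apply: measurableU => //; exact: measurableD.
    by move=> x [Ux _]; have [|] := pselect (A x); [right|left].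
  apply: (@le_trans _ _ (lam (U `\` A) + lam A)%E); last by rewrite A0 adde0.
  by apply: measureU2 => //; exact: measurableD.
pose I := open_disjoint_itv oV.
have VI : V = \bigcup_i I i := open_disjoint_itv_bigcup oV.
have mI i : measurable (I i : set (measurableTypeR R)).
  by apply: measurable_realfun.open_measurable; exact: open_disjoint_itv_open.
have tI : trivIset setT I by exact: open_disjoint_itv_trivIset.
have I01 i : I i `<=` `]0, 1[%classic.
  by move=> x Ix; have [] : V x by rewrite VI; exists i.
have IE i : I i = `]inf (I i), sup (I i)[%classic.
  have oI : open (I i) by exact: open_disjoint_itv_open.
  rewrite -[LHS]((interior_id _).1 oI) interval_bounded_interior.
  - by apply/seteqP; split=> x /=; rewrite in_itv.
  - exact: open_disjoint_itv_is_interval.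
  - by exists 0 => x /I01 /=; rewrite in_itv /= => /andP[/ltW].
  - by exists 1 => x /I01 /=; rewrite in_itv /= => /andP[_ /ltW].
have I0 i : 0 <= inf (I i) /\ inf (I i) <= sup (I i) /\ sup (I i) <= 1.
  have [->|/set0P[x Ix]] := eqVneq (I i) set0; first by rewrite inf0 sup0 lexx ler01.
  have lb0 : lbound (I i) 0 by move=> y /I01 /=; rewrite in_itv /= => /andP[/ltW].
  have ub1 : ubound (I i) 1 by move=> y /I01 /=; rewrite in_itv /= => /andP[_ /ltW].
  split; first by apply: lb_le_inf => //; exists x.
  split; last by apply: ge_sup => //; exists x.
  apply: (@le_trans _ _ x); first by apply: ge_inf => //; exists 0.
  by apply: ub_le_sup => //; exists 1.
apply: (@le_trans _ _ (stieltjes V)).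
  apply: le_measure; rewrite ?inE.
  - exact: measurableI.
  - exact: measurable_realfun.open_measurable.
  - by move=> x [/AU].
have cv : (fun n => \sum_(0 <= i < n) stieltjes (I i))%E @ \oo --> stieltjes V.
  by rewrite VI; apply: measure_sigma_additive.
rewrite -(cvg_lim _ cv)//; apply: lime_le; first exact: cvgP cv.
apply: nearW => n; rewrite big_mkord.
apply: (@le_trans _ _ (\sum_(i < n) (clipped (sup (I i)) - clipped (inf (I i)))%:E)%E).
  apply: lee_sum => i _; have [_ [h _]] := I0 i.
  rewrite -stieltjesE//; apply: le_measure; rewrite ?inE; [exact: mI|exact: measurable_itv|].
  by rewrite {1}IE; apply: subset_itvl; rewrite bnd_simp.
rewrite sumEFin lee_fin.
have := hd n (fun i => inf (I i)) (fun i => sup (I i)) (fun i _ => I0 i).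
move=> h; apply: le_trans (ltW (h _ _)).
- apply: ler_sum => i _; have [h0 [h1 h2]] := I0 i.
  rewrite /clipped !clip_id ?ler_norm//; apply/andP; split => //; first exact: le_trans h1 h2.
  exact: le_trans h1.
- have -> : (fun i => `]inf (I i), sup (I i)[%classic) = I by apply/funext => i; rewrite -IE.
  exact: sub_trivIset tI.
- rewrite -lte_fin -sumEFin; apply: le_lt_trans lV.
  rewrite (eq_bigr (fun i : 'I_n => lam (I i))); last first.
    move=> i _; have [_ [h1 _]] := I0 i.
    rewrite [in RHS]IE lebesgue_measure_itv /= lte_fin; case: ltP => // h2.
    have -> : sup (I i) = inf (I i) by apply/eqP; rewrite eq_le h1 h2.
    by rewrite subrr.
  rewrite -(@measure_semi_additive_ord_I _ _ _ lam I n)//; last 2 first.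
  + exact: sub_trivIset tI.
  + by apply: bigsetU_measurable.
  apply: le_measure; rewrite ?inE//; first exact: bigsetU_measurable.
  by rewrite VI -bigcup_mkord; apply: bigcup_sub => i _; exact: bigcup_sup.
Qed.

(** The density is a Radon-Nikodym derivative of the Stieltjes measure of [phi], and
    Lebesgue's differentiation theorem identifies it with the derivative. *)
Lemma ac_density : exists f : R -> R,
  [/\ measurable_fun setT f, forall x, 0 <= f x,
     {ae lam, forall x, 0 < x < 1 -> derive1 phi x = f x} &
     forall a b, 0 <= a -> a <= b -> b <= 1 ->
       (\int[lam]_(x in `]a, b]) (f x)%:E <= (phi b - phi a)%:E)%E].
Proof.
have [f0 [f00 f0fin f0int f0E]] := radon_nikodym_sigma_finite stieltjes01_dominated.
pose f x := fine (f0 x).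
have fE x : (f x)%:E = f0 x by rewrite /f fineK.
have fE' : EFin \o f = f0 by apply/funext => x; exact: fE.
have fint : lam.-integrable setT (EFin \o f) by rewrite fE'.
have mf : measurable_fun setT f by apply/measurable_EFinP; case/integrableP: fint.
have intE A : measurable A -> (\int[lam]_(x in A) (f x)%:E = stieltjes01 A)%E.
  by move=> mA; rewrite f0E//; apply: eq_integral => x _; rewrite fE.
have phic x : 0 <= x <= 1 -> clipped x = phi x by move=> x01; rewrite /clipped clip_id.
exists f; split => //.
- by move=> x; rewrite -lee_fin fE.
- have locf : locally_integrable setT f.
    by apply: open_integrable_locally => //; exact: openT.
  have := lebesgue_differentiation locf.
  apply: filterS; first exact: (ae_filter_ringOfSetsType lam).
  move=> x lx /andP[x0 x1].
  have f1 : lam.-integrable [set` Interval (BRight 0) (BRight 1)] (EFin \o f).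
    by apply: integrableS fint => //; exact: measurable_itv.
  have [|dF FE] := FTC1_lebesgue_pt x1 f1 _ lx; first exact: x0.
  rewrite -FE !derive1E.
  set F := (fun y => _) in dF FE *.
  transitivity ('D_1 (F + cst (phi 0)) x); last first.
    by rewrite deriveD// derive_cst addr0.
  apply: near_eq_derive => //; near=> y.
  have y0 : 0 < y by near: y; exact: lt_nbhsr.
  have y1 : y < 1 by near: y; exact: lt_nbhsl.
  have FyE : F y = fine (stieltjes01 `]0, y]%classic).
    by rewrite -(intE `]0, y]%classic)//; exact: measurable_itv.
  rewrite fctE /= FyE stieltjes01E.
  have -> : `]0, y]%classic `&` D = `]0, y]%classic.
    apply/setIidl => z /=; rewrite /D /= !in_itv /= => /andP[-> zy].
    exact: le_lt_trans y1.
  have py : clipped y = phi y by apply: phic; rewrite !ltW.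
  have p0 : clipped 0 = phi 0 by apply: phic; rewrite lexx ler01.
  by rewrite stieltjesE ?ltW// py p0 /= subrK.
- move=> a b a0 ab b1; rewrite intE; last exact: measurable_itv.
  rewrite stieltjes01E; apply: (@le_trans _ _ (stieltjes `]a, b]%classic)).
    by apply: measureIl => //; exact: measurable_itv.
  by rewrite stieltjesE// !phic// ?a0 ?b1 ?(le_trans ab)// (le_trans a0).
Unshelve. all: by end_near. Qed.

End Density.

(** * Approximating the functional by boxes *)

Section UniformContinuity.
Context {R : realType} (p : R * R -> R).
Hypothesis pc : {within @unit_square R, continuous p}.

Lemma density_unif_continuous (e : R) : 0 < e -> exists2 del : R, 0 < del &
  forall z z', @unit_square R z -> @unit_square R z' ->
    `|z.1 - z'.1| < del -> `|z.2 - z'.2| < del -> `|p z - p z'| < e.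
Proof.
move=> e0; pose Q := @unit_square R.
have cQ : compact Q by apply: compact_setX; exact: segment_compact.
have /compact_near_coveringP cov := cQ.
pose P (del : R) (z : R * R) := Q z -> forall z', Q z' -> ball z del z' -> `|p z - p z'| < e.
have H : \forall del \near 0^'+, Q `<=` P del.
  apply: cov => x Qx.
  have cx : p @ within Q (nbhs x) --> p x by move/subspace_continuousP : pc; apply.
  have e2 : 0 < e / 2 by rewrite divr_gt0.
  have /nbhs_ballP[r /= r0 hr] : nbhs x [set y | Q y -> `|p x - p y| < e / 2].
    by move/(@cvgrPdist_lt _ R^o) : cx => /(_ _ e2).
  have r2 : 0 < r / 2 by rewrite divr_gt0.
  near=> x' del => Qx' z' Qz' bz.
  have bx : ball x (r / 2) x' by near: x'; exact: nbhsx_ballx.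
  have dr : del < r / 2 by near: del; exact: nbhs_right_lt.
  have h1 : `|p x - p x'| < e / 2.
    by apply: hr => //; apply: le_ball bx; rewrite ler_pdivrMr// ler_pMr// ler1n.
  have h2 : `|p x - p z'| < e / 2.
    apply: hr => //; rewrite [r]splitr; apply: ball_triangle bx _.
    by apply: le_ball bz; exact: ltW.
  rewrite /= (_ : p x' - p z' = (p x - p z') - (p x - p x')); last lra.
  by rewrite [e]splitr; apply: le_lt_trans (ler_normB _ _) _; exact: ltrD.
near (0 : R)^'+ => del.
have del0 : 0 < del by near: del; exact: nbhs_right_gt.
have hdel : Q `<=` P del by near: del.
exists del => // z z' Qz Qz' h1 h2; apply: (hdel z) => //.
Unshelve. all: by end_near. Qed.

End UniformContinuity.

Section AeDomination.
Context d (T : measurableType d) (R : realType) (mu : {measure set T -> \bar R}).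
Local Open Scope ereal_scope.

(** Here [f] need not be measurable; redefining [g] as +oo on the exceptional null set
    reduces to everywhere domination. *)
Lemma ge0_le_integral_ae (D : set T) (f g : T -> \bar R) : measurable D ->
  (forall x, D x -> 0 <= f x) -> (forall x, 0 <= g x) -> measurable_fun setT g ->
  {ae mu, forall x, D x -> f x <= g x} ->
  \int[mu]_(x in D) f x <= \int[mu]_(x in D) g x.
Proof.
move=> mD f0 g0 mg [N [mN N0 hN]].
pose h x := if x \in N then +oo else g x.
have mh : measurable_fun setT h.
  apply: measurable_fun_ifT => //; apply: (measurable_fun_bool true).
  rewrite setTI (_ : _ @^-1` _ = N)//; apply/seteqP; split=> x /=.
    by move/set_mem.
  by move/mem_set.
apply: (@le_trans _ _ (\int[mu]_(x in D) h x)).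
  apply: ge0_le_integralW => // x Dx; rewrite /h; case: ifPn => [_|xN]; first exact: leey.
  apply: contrapT => /negP fg; move/negP: xN; apply; rewrite inE; apply: hN => /= H.
  by move/negP: fg; apply; exact: H.
rewrite le_eqVlt; apply/orP; left; apply/eqP; apply: ge0_ae_eq_integral => //.
- exact: measurable_funTS.
- exact: measurable_funTS.
- by move=> x _; rewrite /h; case: ifP.
exists N; split => // x /= nx; apply: contrapT => xN; apply: nx => _.
by rewrite /h memNset.
Qed.

End AeDomination.

Section OptimalSplit.
Context {R : realType}.

(** The scale c = sqrt (b / a) makes the mean of c a and b / c equal to the geometric mean;
    if b = 0 a small c does. *)
Lemma amgm_scale (a b eta : R) : 0 < a -> 0 <= b -> 0 < eta ->
  exists2 c : R, 0 < c & (c * a + b / c) / 2 <= Num.sqrt (a * b) + eta.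
Proof.
move=> a0 b0 eta0; have [b_eq|b_neq] := eqVneq b 0.
  exists (eta / a); first by rewrite divr_gt0.
  rewrite b_eq mulr0 sqrtr0 mul0r addr0 divfK ?gt_eqF//; lra.
have bpos : 0 < b by rewrite lt_neqAle eq_sym b_neq.
pose s := Num.sqrt (a * b).
have s0 : 0 < s by rewrite sqrtr_gt0 mulr_gt0.
have s2 : s * s = a * b by rewrite -expr2 sqr_sqrtr// mulr_ge0// ltW.
exists (s / a); first by rewrite divr_gt0.
have -> : b / (s / a) = s.
  rewrite invf_div mulrA [b * a]mulrC -s2 -mulrA divff ?mulr1// gt_eqF//.
rewrite divfK ?gt_eqF// -/s; lra.
Qed.

Lemma sqrt_scale (c M f : R) : 0 < c -> 0 <= M -> 0 <= f ->
  Num.sqrt (M * f) <= (c * M + f / c) / 2.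
Proof.
move=> c0 M0 f0; have x0 : 0 <= c * M by rewrite mulr_ge0// ltW.
have y0 : 0 <= f / c by rewrite divr_ge0// ltW.
have xy : (c * M) * (f / c) = M * f.
  have cc : c / c = 1 by rewrite divff// gt_eqF.
  by move: cc; set ci := c^-1 => cc; rewrite -[RHS]mul1r -cc; lra.
have h0 : 0 <= (c * M + f / c) / 2 by rewrite divr_ge0// addr_ge0.
rewrite -(ger0_norm h0) -sqrtr_sqr ler_wsqrtr// -xy.
move: x0 y0 {xy h0}; set x := c * M; set y := f / c => x0 y0.
have := sqr_ge0 (x - y); lra.
Qed.
Lemma sqrt_split (m M dx dy eta : R) : 0 <= m -> 0 <= dx -> 0 <= dy -> 0 < eta ->
  M <= m + eta ^+ 2 / 16 ->
  Num.sqrt (M * (dx * dy)) <= Num.sqrt (m * (dx * dy)) + eta / 4 * ((dx + dy) / 2).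
Proof.
move=> m0 dx0 dy0 eta0 Mm; have w0 : 0 <= dx * dy by rewrite mulr_ge0.
set s := Num.sqrt (m * _); set r := eta / 4 * _.
have s0 : 0 <= s by exact: sqrtr_ge0.
have r0 : 0 <= r by rewrite mulr_ge0 ?divr_ge0 ?addr_ge0// ltW.
have s2 : s ^+ 2 = m * (dx * dy) by rewrite sqr_sqrtr// mulr_ge0.
have r2 : eta ^+ 2 / 16 * (dx * dy) <= r ^+ 2.
  have h := mulr_ge0 (sqr_ge0 eta) (sqr_ge0 (dx - dy)); rewrite /r; lra.
rewrite -(ger0_norm (addr_ge0 s0 r0)) -sqrtr_sqr ler_wsqrtr//.
have := ler_wpM2r w0 Mm; have := mulr_ge0 s0 r0; move: s2 r2; clearbody s r; lra.
Qed.

End OptimalSplit.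

Section PathIntegral.
Context {R : realType} (p : R * R -> R) (phi : R -> R).
Hypothesis pc : {within @unit_square R, continuous p}.
Hypothesis p0 : forall z, @unit_square R z -> 0 < p z.
Hypothesis phiB : Bup phi.
Notation lam := (@lebesgue_measure R).

Lemma Bup_unif_continuous (e : R) : 0 < e -> exists2 del : R, 0 < del &
  forall x y, 0 <= x -> x <= y -> y <= 1 -> y - x < del -> phi y - phi x < e.
Proof.
case: phiB => _ ac _ e0; have [del del0 hd] := ac e e0; exists del => // x y x0 xy y1 h.
have := hd 1%N (fun=> x) (fun=> y); rewrite !big_ord1 => H.
apply: le_lt_trans (ler_norm _) _; apply: H => //.
by move=> i j /=; rewrite !ltnS !leqn0 => /eqP -> /eqP ->.
Qed.

(** On the i-th piece the integrand is at most (c_i M_i + f / c_i) / 2, where M_i bounds the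
    density along the path and f is the derivative of phi.  Its integral is
    (c_i M_i dx + dy_i / c_i) / 2, and the best c_i gives sqrt (M_i dx dy_i).  By uniform
    continuity M_i exceeds the lower bound m_i by little. *)
Lemma path_integral_boxes (eta : R) : 0 < eta -> exists K : nat, exists m : nat -> R,
  let x i := i%:R / K%:R in
  [/\ (0 < K)%N,
    forall i, (i < K)%N -> 0 <= m i /\
      forall z, box (x i) (x i.+1) (phi (x i)) (phi (x i.+1)) z -> m i <= p z &
    (\int[lam]_(t in `[0%R, 1%R]) (Num.sqrt (p (t, phi t) * derive1 phi t))%:E <=
      (\sum_(i < K) Num.sqrt (m i * ((x i.+1 - x i) * (phi (x i.+1) - phi (x i)))) + eta)%:E)%E].
Proof.
move=> eta0.
have [f [mf f0 fae fint]] := ac_density phiB.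
(* M_i - m_i is then at most eta^2 / 16, so that sqrt M_i - sqrt m_i is at most eta / 4. *)
pose e := eta ^+ 2 / 32.
have e0 : 0 < e by rewrite divr_gt0// exprn_gt0.
have [d1 d10 hd1] := density_unif_continuous pc e0.
have [d2 d20 hd2] := Bup_unif_continuous d10.
have dm0 : 0 < Num.min d1 d2 by rewrite lt_min d10.
pose K := (Num.truncn ((Num.min d1 d2)^-1)).+1.
have K0 : 0 < K%:R :> R by rewrite ltr0n.
have Kd : K%:R^-1 < Num.min d1 d2.
  by rewrite -[ltRHS]invrK ltf_pV2 ?posrE ?invr_gt0// truncnS_gt.
move: Kd; rewrite lt_min => /andP[Kd1 Kd2].
pose x (i : nat) : R := i%:R / K%:R.
have xS i : x i.+1 - x i = K%:R^-1 by rewrite /x -mulrBl -natr1 addrC addKr mul1r.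
have x01 i : (i <= K)%N -> 0 <= x i <= 1.
  by move=> iK; rewrite divr_ge0//= ler_pdivrMr// mul1r ler_nat.
case: (phiB) => nd _ rg.
have nd' a b : 0 <= a -> a <= b -> b <= 1 -> phi a <= phi b.
  by move=> a0 ab b1; apply: nd => //; rewrite in_itv /= ?a0 ?b1 ?(le_trans ab) ?(le_trans a0).
have rg' a : 0 <= a <= 1 -> 0 <= phi a <= 1.
  by move=> a01; have := rg a; rewrite !in_itv /=; apply.
have Q a : 0 <= a <= 1 -> @unit_square R (a, phi a).
  by move=> a01; split; rewrite /= in_itv /= ?a01 ?rg'.
pose P i := p (x i, phi (x i)).
pose m i := Num.max (P i - e) 0.
(* The upper and lower bounds of the density on the i-th box. *)
pose M i := P i + e.
have xle i : x i <= x i.+1 by rewrite -subr_ge0 xS invr_ge0 ltW.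
have inQ i (u v : R) : (i < K)%N -> x i <= u -> u <= x i.+1 ->
    phi (x i) <= v -> v <= phi (x i.+1) -> @unit_square R (u, v).
  move=> iK a1 a2 b1 b2.
  have /andP[xi0 _] := x01 i (ltnW iK); have /andP[_ xi1] := x01 i.+1 iK.
  have /andP[r0 _] := rg' _ (x01 i (ltnW iK)); have /andP[_ r1] := rg' _ (x01 i.+1 iK).
  split; rewrite /= in_itv /=; apply/andP; split.
  - exact: le_trans a1.
  - exact: le_trans xi1.
  - exact: le_trans b1.
  - exact: le_trans r1.
have near_p i z : (i < K)%N -> x i <= z.1 -> z.1 <= x i.+1 ->
    phi (x i) <= z.2 -> z.2 <= phi (x i.+1) -> `|P i - p z| < e.
  move=> iK a1 a2 b1 b2.
  have /andP[xi0 _] := x01 i (ltnW iK); have /andP[_ xi1] := x01 i.+1 iK.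
  have h := hd2 (x i) (x i.+1) xi0 (xle i) xi1; rewrite xS in h.
  apply: hd1.
  - by apply: Q; exact: x01 (ltnW iK).
  - by case: z a1 a2 b1 b2 => u v /= a1 a2 b1 b2; exact: inQ a1 a2 b1 b2.
  - rewrite distrC ger0_norm ?subr_ge0//; apply: le_lt_trans Kd1.
    by rewrite -(xS i) lerD2r.
  - rewrite distrC ger0_norm ?subr_ge0//; apply: le_lt_trans (h Kd2).
    by rewrite lerD2r.
exists K, m; split => //.
  move=> i iK; split; first by rewrite le_max lexx orbT.
  move=> [u v] [/= + +]; rewrite !in_itv /= => /andP[u1 u2] /andP[v1 v2].
  have := near_p i (u, v) iK (ltW u1) u2 (ltW v1) v2.
  rewrite ltr_norml => /andP[_ h].
  rewrite ge_max; apply/andP; split; first by rewrite /=; lra.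
  by apply/ltW/p0; exact: inQ (ltW u1) u2 (ltW v1) v2.
pose dy i := phi (x i.+1) - phi (x i).
have dy0 i : (i < K)%N -> 0 <= dy i.
  move=> iK; rewrite subr_ge0; apply: nd' (xle i) _.
    by have /andP[] := x01 i (ltnW iK).
  by have /andP[] := x01 i.+1 iK.
have M0 i : (i < K)%N -> 0 < M i.
  by move=> iK; rewrite addr_gt0// p0//; apply: Q; exact: x01 (ltnW iK).
have eK0 : 0 < eta / 4 / K%:R by rewrite !divr_gt0.
have /choice[c hc] : forall i, exists c, (i < K)%N ->
    0 < c /\ (c * (M i / K%:R) + dy i / c) / 2 <= Num.sqrt (M i / K%:R * dy i) + eta / 4 / K%:R.
  move=> i; case: (ltnP i K) => iK; last by exists 0.
  have [c c0 hc] := amgm_scale (divr_gt0 (M0 i iK) K0) (dy0 i iK) eK0.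
  by exists c.
pose A i : set R := `]x i, x i.+1]%classic.
pose u i t : R := c i * M i / 2 + (c i)^-1 / 2 * f t.
pose g i : R -> \bar R := (EFin \o u i) \_ (A i).
have u0 i t : (i < K)%N -> 0 <= u i t.
  move=> iK; have [c0 _] := hc i iK.
  apply: addr_ge0; first by apply: divr_ge0 => //; apply: mulr_ge0; apply: ltW => //; exact: M0.
  by apply: mulr_ge0 => //; apply: divr_ge0 => //; rewrite invr_ge0 ltW.
have mA i : measurable (A i) by exact: measurable_itv.
have mu_ i : measurable_fun setT (EFin \o u i).
  by apply/measurable_EFinP; apply: measurable_funD => //; exact: measurable_funM.
pose G t : \bar R := (\sum_(i < K) g i t)%E.
have g0 (i : 'I_K) t : (0 <= g i t)%E.
  by rewrite /g /patch; case: ifP => // _; rewrite lee_fin u0.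
have mg i : measurable_fun setT (g i).
  have h : measurable_fun (A i) (EFin \o u i) := measurable_funTS (mu_ i).
  by move: h; rewrite (measurable_restrictT _ (mA i)).
have mI : measurable (`[0%R, 1%R]%classic : set (measurableTypeR R)) by exact: measurable_itv.
apply: (@le_trans _ _ (\int[lam]_(t in `[0%R, 1%R]) G t)%E).
  have mG : measurable_fun setT G by exact: emeasurable_sum.
  apply: (ge0_le_integral_ae mI _ _ mG) => [t _|t|].
  - by rewrite lee_fin sqrtr_ge0.
  - by apply: sume_ge0 => i _.
  have ae01 : {ae lam, forall t : R, t != 0 /\ t != 1}.
    exists ([set 0] `|` [set 1]); split.
    - by apply: measurableU; exact: measurable_set1.
    - apply/eqP; rewrite -measure_le0.
      apply: (@le_trans _ _ (lam [set 0%R] + lam [set 1%R])%E).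
        by apply: measureU2; exact: measurable_set1.
      by rewrite !lebesgue_measure_set1 adde0.
    - move=> t /= h; have [->|t0] := eqVneq t 0; first by left.
      by have [->|t1] := eqVneq t 1; [right|exfalso; apply: h; split].
  move: fae ae01; apply: filterS2; first exact: (ae_filter_ringOfSetsType lam).
  move=> t ht [t_0 t_1]; rewrite /= in_itv /= => /andP[t0 t1].
  have {}t0 : 0 < t by rewrite lt_neqAle eq_sym t_0.
  have {}t1 : t < 1 by rewrite lt_neqAle t_1.
  rewrite ht ?t0//.
  have [i iK [ti1 ti2]] : exists2 i, (i < K)%N & x i < t /\ t <= x i.+1.
    have exj : exists j, t <= x j.+1.
      by exists K.-1; rewrite /x /K /= divff ?pnatr_eq0// ltW.
    case: (ex_minnP exj) => j tj jmin; exists j.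
      rewrite ltnNge; apply/negP => Kj.
      have := jmin K.-1; rewrite /x /K /= divff ?pnatr_eq0// (ltW t1) => /(_ isT).
      by rewrite leqNgt; move: Kj; rewrite /K => ->.
    split => //; case: j tj jmin => [_ _|j tj jmin]; first by rewrite /x mul0r.
    by rewrite ltNge; apply/negP => /jmin; rewrite ltnn.
  have tQ := inQ i t (phi t) iK (ltW ti1) ti2.
  have xi0 : 0 <= x i by have /andP[] := x01 i (ltnW iK).
  have xi1 : x i.+1 <= 1 by have /andP[] := x01 i.+1 iK.
  have ph1 : phi (x i) <= phi t by apply: nd' => //; exact: ltW.
  have ph2 : phi t <= phi (x i.+1) by apply: nd' => //; exact: ltW.
  have pM : p (t, phi t) <= M i.
    have := near_p i (t, phi t) iK (ltW ti1) ti2 ph1 ph2.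
    rewrite ltr_norml /M => /andP[h _]; lra.
  have [c0 _] := hc i iK.
  apply: (@le_trans _ _ (u i t)%:E).
    rewrite lee_fin; apply: le_trans (_ : Num.sqrt (M i * f t) <= _).
      by rewrite ler_wsqrtr// ler_wpM2r.
    by apply: le_trans (sqrt_scale c0 (ltW (M0 i iK)) (f0 t)) _; rewrite /u; lra.
  rewrite /G (bigD1 (Ordinal iK)) //= /g patchE mem_set; last first.
    by rewrite /A /= in_itv /= ti1.
  by rewrite leeDl//; apply: sume_ge0 => j _; exact: g0.
rewrite (ge0_integral_sum _ mI); last 2 first.
- by move=> i; apply: measurable_funTS; exact: mg.
- by move=> i t _.
have intg (i : 'I_K) : (\int[lam]_(t in `[0%R, 1%R]) g i t <=
    (Num.sqrt (m i * ((x i.+1 - x i) * dy i)) + eta / 4 * ((K%:R^-1 + dy i) / 2) + eta / 4 / K%:R)%:E)%E.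
  have iK := ltn_ord i; have [c0 hci] := hc i iK.
  have sub : `[0%R, 1%R]%classic `&` A i = A i.
    apply/setIidr => t; rewrite /A /= !in_itv /= => /andP[t0 t1].
    have /andP[xi0 _] := x01 i (ltnW iK); have /andP[_ xi1] := x01 i.+1 iK.
    by rewrite (le_trans xi0 (ltW t0)) (le_trans t1).
  rewrite /g -integral_mkcondr sub.
  have ci0 : 0 <= (c i)^-1 / 2 by rewrite divr_ge0// invr_ge0 ltW.
  have cM0 : 0 <= c i * M i / 2 by rewrite divr_ge0// mulr_ge0 ?ltW// M0.
  have /andP[xi0 _] := x01 i (ltnW iK); have /andP[_ xi1] := x01 i.+1 iK.
  have mA' : measurable (A i : set (measurableTypeR R)) by exact: measurable_itv.
  have lA : lam (A i) = (K%:R^-1)%:E.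
    by rewrite /A lebesgue_measure_itv /= lte_fin -subr_gt0 xS invr_gt0 K0 -EFinD xS.
  have mf' : measurable_fun (A i) (EFin \o f).
    by apply: measurable_funTS; apply/measurable_EFinP.
  have -> : (\int[lam]_(t in A i) (EFin \o u i) t =
      (c i * M i / 2)%:E * (K%:R^-1)%:E + ((c i)^-1 / 2)%:E * \int[lam]_(t in A i) (f t)%:E)%E.
    under eq_integral do rewrite /= EFinD (EFinM ((c i)^-1 / 2)).
    rewrite ge0_integralD//; last 2 first.
    - by move=> t _; rewrite mule_ge0// lee_fin.
    - by apply: measurable_funeM.
    rewrite ge0_integralZl_EFin//; last by move=> t _; rewrite lee_fin.
    congr (_ + _)%E; rewrite [LHS]integral_cst//; congr (_ * _)%E.
    exact: lA.
  have fi : (\int[lam]_(t in A i) (f t)%:E <= (dy i)%:E)%E by exact: fint.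
  apply: (@le_trans _ _ ((c i * M i / 2)%:E * (K%:R^-1)%:E + ((c i)^-1 / 2)%:E * (dy i)%:E)%E).
    by rewrite leeD2l// lee_wpmul2l// lee_fin.
  rewrite -!EFinM -EFinD lee_fin.
  have h1 : c i * M i / 2 / K%:R + (c i)^-1 / 2 * dy i =
      (c i * (M i / K%:R) + dy i / c i) / 2 by lra.
  rewrite h1; apply: le_trans hci _; rewrite lerD2r xS.
  have -> : M i / K%:R * dy i = M i * (K%:R^-1 * dy i) by rewrite mulrA.
  apply: sqrt_split => //; first by rewrite le_max lexx orbT.
  - exact: dy0.
  rewrite /M /m /e; have : P i - eta ^+ 2 / 32 <= Num.max (P i - eta ^+ 2 / 32) 0.
    by rewrite le_max lexx.
  lra.
apply: le_trans (lee_sum _ (fun i _ => intg i)) _.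
rewrite sumEFin lee_fin !big_split /= -/dy -addrA lerD2l.
have sK : \sum_(i < K) eta / 4 / K%:R = eta / 4.
  by rewrite sumr_const card_ord -[LHS]mulr_natr divfK// gt_eqF.
have sd : \sum_(i < K) dy i <= 1.
  rewrite -(big_mkord xpredT dy) telescope_sumr//.
  have /andP[h1 _] := rg' _ (x01 0%N isT); have /andP[_ h2] := rg' _ (x01 K (leqnn K)).
  lra.
have sx : \sum_(i < K) K%:R^-1 = 1 :> R.
  by rewrite sumr_const card_ord -[LHS]mulr_natr mulVf// gt_eqF.
rewrite sK -mulr_sumr -mulr_suml big_split /= sx.
have : eta / 4 * ((1 + \sum_(i < K) dy i) / 2) <= eta / 4 * 1.
  by rewrite ler_pM2l ?divr_gt0//; lra.
lra.
Qed.

End PathIntegral.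

(** * Finiteness of Jbar, measurability, and concatenation of chains *)

Section JbarFinite.
Context {R : realType} (p : R * R -> R).
Hypothesis pc : {within @unit_square R, continuous p}.
Hypothesis p0 : forall z, @unit_square R z -> 0 < p z.

Lemma density_bounded : exists B : R, forall z, @unit_square R z -> p z <= B.
Proof.
have cQ : compact (@unit_square R) by apply: compact_setX; exact: segment_compact.
have [B [_ hB]] := compact_bounded (continuous_compact pc cQ : @compact R^o _).
exists (B + 1) => z Qz; apply: le_trans (ler_norm _) _.
by apply: hB; [rewrite ltrDl|exists z].
Qed.

Lemma Jbar_ge0 : (0 <= Jbar p)%E.
Proof.
apply: (@le_trans _ _ (\int[@lebesgue_measure R]_(x in `[0%R, 1%R])
    (Num.sqrt (p (x, 0) * derive1 (fun=> 0 : R) x))%:E)%E).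
  by apply: integral_ge0 => x _; rewrite lee_fin sqrtr_ge0.
apply: ereal_sup_ubound; exists (fun=> 0) => //; split => //.
- move=> e e0; exists 1 => // n u v _ _ _.
  by rewrite big1// => i _; rewrite subrr normr0.
- by move=> x _; rewrite in_itv /= lexx ler01.
Qed.

(** With a bound B of the density, each term of [path_integral_boxes] is at most
    (B dx + dy) / 2, and these sum to at most (B + 1) / 2. *)
Lemma Jbar_fin_num : Jbar p \is a fin_num.
Proof.
have [B hB] := density_bounded.
have B0 : 0 <= B.
  have Q0 : @unit_square R (0, 0) by split; rewrite /= in_itv /= lexx ler01.
  by apply: le_trans (hB _ Q0); apply/ltW/p0.
rewrite ge0_fin_numE ?Jbar_ge0//.
apply: (@le_lt_trans _ _ ((B + 1) / 2 + 1)%:E); last exact: ltry.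
apply: ge_ereal_sup => _ [phi phiB <-].
have [K [m [K0 mp]]] := path_integral_boxes pc p0 phiB ltr01.
move=> h; apply: le_trans h _; rewrite lee_fin lerD2r.
case: (phiB) => nd _ rg.
have KR0 : 0 < K%:R :> R by rewrite ltr0n.
have x01 i : (i <= K)%N -> (i%:R / K%:R : R) \in `[0, 1].
  by move=> iK; rewrite in_itv /= divr_ge0//= ler_pdivrMr// mul1r ler_nat.
pose dx (i : nat) : R := i.+1%:R / K%:R - i%:R / K%:R.
have dxE i : dx i = K%:R^-1 by rewrite /dx -mulrBl -natr1 addrC addKr mul1r.
pose dy (i : nat) : R := phi (i.+1%:R / K%:R) - phi (i%:R / K%:R).
have xi i : i%:R / K%:R < i.+1%:R / K%:R :> R by rewrite ltr_pM2r ?invr_gt0// ltr_nat.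
have dy0 i : (i < K)%N -> 0 <= dy i.
  by move=> iK; rewrite subr_ge0; apply: nd; rewrite ?x01 ?(ltnW iK)// ltW.
apply: (@le_trans _ _ (\sum_(i < K) (B * K%:R^-1 + dy i) / 2)).
  apply: ler_sum => i _; have iK := ltn_ord i.
  rewrite -/(dx i) -/(dy i) dxE.
  have [dyi|dyi] := eqVneq (dy i) 0.
    by rewrite dyi !mulr0 sqrtr0 addr0 divr_ge0// mulr_ge0// invr_ge0.
  have [m0 mi] := mp i iK.
  have mB : m i <= B.
    pose z := (i.+1%:R / K%:R, phi (i.+1%:R / K%:R)) : R * R.
    apply: le_trans (mi z _) (hB z _).
      split; rewrite /= in_itv /= lexx andbT; first exact: xi.
      by rewrite -subr_gt0 lt_neqAle eq_sym dyi dy0.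
    by split => /=; [|apply: rg]; exact: x01.
  have sB : 0 <= B * K%:R^-1 by rewrite mulr_ge0// invr_ge0.
  apply: le_trans (_ : Num.sqrt ((B * K%:R^-1) * dy i) <= _).
    rewrite ler_wsqrtr// mulrA ler_wpM2r ?dy0// ler_wpM2r// invr_ge0//.
  apply: le_trans (sqrt_scale ltr01 sB (dy0 _ iK)) _.
  by rewrite mul1r divr1.
rewrite -mulr_suml big_split /= sumr_const card_ord -[_ *+ _]mulr_natr divfK ?gt_eqF//.
rewrite ler_pM2r ?invr_gt0// lerD2l.
rewrite -(big_mkord xpredT dy) telescope_sumr//.
have := rg _ (x01 0%N isT); have := rg _ (x01 K (leqnn K)).
by rewrite !in_itv /= => /andP[_ h1] /andP[h2 _]; lra.
Qed.

End JbarFinite.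

Section Measurability.
Context d (T : measurableType d).

(** An event that depends on finitely many events is a finite union of finite
    intersections of them and their complements. *)
Lemma measurable_finite_pattern (I : finType) (b : I -> T -> bool) (A : {ffun I -> bool} -> Prop) :
  (forall i, measurable [set w | b i w]) ->
  measurable [set w | A [ffun i => b i w]].
Proof.
move=> mb.
have mbb i c : measurable [set w | b i w = c].
  case: c; first exact: mb.
  rewrite (_ : [set w | b i w = false] = ~` [set w | b i w]); first exact: measurableC.
  by apply/seteqP; split=> w /=; [move->|move/negP/negbTE].
rewrite (_ : [set w | _] = \bigcup_(s in [set s | A s])
    \bigcap_(i in [set: I]) [set w | b i w = s i]).
  apply: fin_bigcup_measurable => // s _.
  by apply: fin_bigcap_measurable => // i _.
apply/seteqP; split=> w /=.
  by move=> Aw; exists [ffun i => b i w] => //= i _; rewrite ffunE.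
by case=> s As h; rewrite (_ : [ffun i => b i w] = s)//; apply/ffunP => i; rewrite ffunE h.
Qed.

End Measurability.

Section Assembly.
Context (R : realType) (d : measure_display)
    (Omega : measurableType d) (P : probability Omega R)
    (Z : nat -> {RV P >-> plane R}).

Lemma measurable_longest_increasing n (A : nat -> Prop) :
  measurable [set w | A (longest_increasing n (fun i => Z i w : R * R))].
Proof.
pose b (ij : 'I_n * 'I_n) w := below (fun i => Z i w : R * R) ij.1 ij.2.
pose len (s : {ffun 'I_n * 'I_n -> bool}) := (\max_(l < n.+1 | [exists t : l.-tuple 'I_n,
      sorted [rel i j : 'I_n | s (i, j)] t]) (l : nat))%N.
rewrite (_ : [set w | _] = [set w | A (len [ffun ij => b ij w])]).
  apply: (@measurable_finite_pattern _ _ _ b (fun s => A (len s))) => -[i j].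
  have m1 k : measurable_fun setT (fun w => (Z k w).1 : R).
    by apply: measurableT_comp.
  have m2 k : measurable_fun setT (fun w => (Z k w).2 : R).
    by apply: measurableT_comp.
  have h : measurable_fun setT (fun w => b (i, j) w).
    by apply: measurable_and; exact: measurable_fun_ltr.
  by rewrite -[X in measurable X]setTI; apply: (h measurableT [set true]).
apply/seteqP; split=> w /=; rewrite (_ : longest_increasing _ _ = len [ffun ij => b ij w])//;
  apply: eq_bigl => l; apply: eq_existsb => t; apply: eq_sorted => x y; rewrite /= ffunE //.
Qed.

(** The exceptional event is enclosed in a measurable set [G], so that it need not be
    measurable itself. *)
Definition likely_chain (D : set (R * R)) (v : R) : Prop :=
  exists kappa C : R, exists N0, [/\ 0 < kappa, 0 < C &
    forall n, (N0 <= n)%N -> exists G : set Omega,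
    [/\ measurable G, pr P G <= C * expR (- (kappa * n%:R)) &
    forall w, ~ G w -> has_chain n (fun i => Z i w : R * R) D (v * Num.sqrt n%:R)]].

Lemma likely_chain_trivial D v : v <= 0 -> likely_chain D v.
Proof.
move=> v0; exists 1, 1, 0%N; split => // n _; exists set0; split => //.
  by rewrite pr0 mul1r expR_ge0.
move=> w _; exists [::]; split => //=; by rewrite mulr_le0_ge0// sqrtr_ge0.
Qed.

Lemma has_chain_cat n (z : nat -> R * R) (D1 D2 D : set (R * R)) v1 v2 :
  has_chain n z D1 v1 -> has_chain n z D2 v2 -> D1 `<=` D -> D2 `<=` D ->
  (forall a b, D1 a -> D2 b -> (a.1 < b.1) && (a.2 < b.2)) ->
  has_chain n z D (v1 + v2).
Proof.
move=> [t1 [vt1 st1 Dt1]] [t2 [vt2 st2 Dt2]] D1D D2D D12.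
exists (t1 ++ t2); split.
- by rewrite size_cat natrD lerD.
- apply: (sorted_cat (@below_trans _ n z)) => // i j it jt.
  by apply: D12; [exact: Dt1|exact: Dt2].
- by move=> i; rewrite mem_cat => /orP[/Dt1/D1D|/Dt2/D2D].
Qed.

Lemma likely_chain_cat (D1 D2 D : set (R * R)) v1 v2 :
  likely_chain D1 v1 -> likely_chain D2 v2 -> D1 `<=` D -> D2 `<=` D ->
  (forall a b, D1 a -> D2 b -> (a.1 < b.1) && (a.2 < b.2)) ->
  likely_chain D (v1 + v2).
Proof.
move=> [k1 [C1 [N1 [k10 C10 h1]]]] [k2 [C2 [N2 [k20 C20 h2]]]] D1D D2D D12.
exists (Num.min k1 k2), (C1 + C2), (maxn N1 N2); split.
- by rewrite lt_min k10.
- exact: addr_gt0.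
move=> n; rewrite geq_max => /andP[/h1[G1 [mG1 pG1 c1]] /h2[G2 [mG2 pG2 c2]]].
exists (G1 `|` G2); split; first exact: measurableU.
- apply: (@le_trans _ _ (pr P G1 + pr P G2)).
    rewrite -lee_fin EFinD -!prE//; last exact: measurableU.
    exact: measureU2.
  rewrite mulrDl; apply: lerD.
    apply: le_trans pG1 _; rewrite ler_pM2l// ler_expR lerN2 ler_wpM2r//.
    by rewrite ge_min lexx.
  apply: le_trans pG2 _; rewrite ler_pM2l// ler_expR lerN2 ler_wpM2r//.
  by rewrite ge_min lexx orbT.
- move=> w /not_orP[n1 n2]; rewrite mulrDl.
  exact: has_chain_cat (c1 _ n1) (c2 _ n2) D1D D2D D12.
Qed.

Lemma limn_esup_lne_lt0 (u : (\bar R)^nat) (C k : R) (N : nat) : 0 < k -> 0 < C ->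
  (forall n, (N <= n)%N -> u n <= (n%:R^-1)%:E * lne ((C * expR (- (k * n%:R)))%:E))%E ->
  (limn_esup u < 0)%E.
Proof.
move=> k0 C0 hu; apply: (@le_lt_trans _ _ (- (k / 2))%:E); last first.
  by rewrite lte_fin oppr_lt0 divr_gt0.
pose N' := maxn N (Num.truncn (ln C * 2 / k)).+1.
rewrite limn_esup_lim; apply: lime_le; first exact: is_cvg_esups.
exists N' => // m /= mN; apply: ge_ereal_sup => _ [n /= mn <-].
have : (N' <= n)%N by exact: leq_trans mN mn.
rewrite geq_max => /andP[nN nC].
apply: le_trans (hu n nN) _.
have n0 : 0 < n%:R :> R by rewrite ltr0n; exact: leq_ltn_trans nC.
rewrite lne_EFin ?mulr_gt0 ?expR_gt0// lnM ?posrE ?expR_gt0// expRK -EFinM lee_fin.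
have : ln C * 2 / k <= n%:R.
  by apply: le_trans (ltW (truncnS_gt _)) _; rewrite ler_nat.
rewrite ler_pdivrMr// => h.
rewrite mulrC ler_pdivrMr//; lra.
Qed.

End Assembly.

(** * The lower tail along a nearly optimal function *)

Section Main.
Context (R : realType) (d : measure_display)
    (Omega : measurableType d) (P : probability Omega R)
    (mu : probability (plane R) R) (p : R * R -> R)
    (Z : nat -> {RV P >-> plane R}).
Hypothesis pc : {within @unit_square R, continuous p}.
Hypothesis p0 : forall z, @unit_square R z -> 0 < p z.
Hypothesis dens : has_density_on_unit_square mu p.
Hypothesis iidZ : iid_with_law Z mu.

(** Boxes of area zero, or with a vanishing lower bound of the density, contribute nothing
    to the sum and are skipped by the empty chain. *)
Lemma likely_chain_below_Jbar (v : R) : (v%:E < 2%:E * Jbar p)%E -> likely_chain Z setT v.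
Proof.
move=> vJ.
have [v0|v0] := leP v 0; first exact: likely_chain_trivial.
have [J JE] : exists J, Jbar p = J%:E.
  by exists (fine (Jbar p)); rewrite fineK// Jbar_fin_num.
rewrite JE -EFinM lte_fin in vJ.
pose gap := 2 * J - v.
have gap0 : 0 < gap by rewrite subr_gt0.
(* Half of the gap is spent on the approximation of Jbar by boxes, the rest on the
     constant 2 - 12 e. *)
pose ep := gap / 8.
have ep0 : 0 < ep by rewrite divr_gt0.
have J0 : 0 < J by lra.
pose e := Num.min 12^-1 (gap / (48 * J)).
have e0 : 0 < e by rewrite lt_min invr_gt0 ltr0n /= divr_gt0// mulr_gt0.
have e12 : e <= 12^-1 by rewrite ge_min lexx.
have eJ : 48 * (e * J) <= gap.
  rewrite mulrCA -ler_pdivlMr ?mulr_gt0//.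
  by rewrite ge_min lexx orbT.
have [_ [phi phiB <-] Jphi] : exists2 y, [set \int[@lebesgue_measure R]_(x in `[0%R, 1%R])
    (Num.sqrt (p (x, phi x) * derive1 phi x))%:E | phi in @Bup R]%E y & ((J - ep)%:E < y)%E.
  by apply: ereal_sup_gt; rewrite -/(Jbar p) JE lte_fin ltrBlDr ltrDl.
have [K [m [K0 mp hK]]] := path_integral_boxes pc p0 phiB ep0.
have KR0 : 0 < K%:R :> R by rewrite ltr0n.
case: (phiB) => nd _ rg.
pose x (i : nat) : R := i%:R / K%:R.
have x01 i : (i <= K)%N -> 0 <= x i <= 1.
  by move=> iK; rewrite divr_ge0//= ler_pdivrMr// mul1r ler_nat.
have y01 i : (i <= K)%N -> 0 <= phi (x i) <= 1.
  by move=> iK; have := rg (x i); rewrite !in_itv /=; apply; exact: x01.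
have xlt i : x i < x i.+1 by rewrite ltr_pM2r ?invr_gt0// ltr_nat.
have yle i : (i < K)%N -> phi (x i) <= phi (x i.+1).
  by move=> iK; apply: nd; rewrite ?in_itv /= ?x01// ?(ltnW iK)// ltW.
pose s i := Num.sqrt (m i * ((x i.+1 - x i) * (phi (x i.+1) - phi (x i)))).
have sgood i : (i < K)%N ->
    likely_chain Z (box (x i) (x i.+1) (phi (x i)) (phi (x i.+1))) ((2 - 12 * e) * s i).
  move=> iK; have [m0 mi] := mp i iK.
  have [y_eq|y_neq] := eqVneq (phi (x i)) (phi (x i.+1)).
    by apply: likely_chain_trivial; rewrite /s y_eq subrr !mulr0 sqrtr0 mulr0.
  have [m_eq|m_neq] := eqVneq (m i) 0.
    by apply: likely_chain_trivial; rewrite /s m_eq mul0r sqrtr0 mulr0.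
  have /andP[xi0 _] := x01 i (ltnW iK); have /andP[_ xi1] := x01 i.+1 iK.
  have /andP[yi0 _] := y01 i (ltnW iK); have /andP[_ yi1] := y01 i.+1 iK.
  have ylt : phi (x i) < phi (x i.+1) by rewrite lt_neqAle y_neq yle.
  have mpos : 0 < m i by rewrite lt_neqAle eq_sym m_neq.
  have [ka [C [N [ka0 C0 h]]]] :=
    rectangle_tail dens iidZ xi0 (xlt i) xi1 yi0 ylt yi1 mpos mi e0 e12.
  exists ka, C, N; split => // n /h[G [mG pG cG]]; exists G; split => // w nG.
  by rewrite -mulrA; exact: cG.
have chain j : (j <= K)%N -> likely_chain Z
    [set z | z.1 <= x j /\ z.2 <= phi (x j)] ((2 - 12 * e) * \sum_(i < j) s i).
  elim: j => [|j IH] jK; first by apply: likely_chain_trivial; rewrite big_ord0 mulr0.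
  rewrite big_ord_recr mulrDr /=.
  apply: (likely_chain_cat (IH (ltnW jK)) (sgood j jK)).
  - move=> z [z1 z2]; split; first by apply: le_trans z1 _; exact: ltW.
    by apply: le_trans z2 _; exact: yle.
  - by move=> [a b] [/= + +]; rewrite !in_itv /= => /andP[_ ?] /andP[_ ?].
  - move=> a [b b'] [a1 a2] [/= + +]; rewrite !in_itv /= => /andP[b1 _] /andP[b2 _].
    by rewrite (le_lt_trans a1 b1) (le_lt_trans a2 b2).
have [ka [C [N [ka0 C0 h]]]] := chain K (leqnn K).
have S_ge : J - 2 * ep <= \sum_(i < K) s i.
  have := lt_le_trans Jphi hK; rewrite lte_fin -/(x _) => hJ.
  have {}hJ : J - ep < \sum_(i < K) s i + ep by exact: hJ.
  lra.
exists ka, C, N; split => // n /h[G [mG pG cG]]; exists G; split => // w nG.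
have [t [vt st _]] := cG w nG; exists t; split => //.
apply: le_trans vt; rewrite ler_wpM2r ?sqrtr_ge0//.
have ee : 0 <= 2 - 12 * e by lra.
apply: le_trans (ler_wpM2l ee S_ge).
have ep_ge0 : 0 <= e * ep by rewrite mulr_ge0// ltW.
rewrite /ep /gap in eJ ep_ge0 *; lra.
Qed.

End Main.

Theorem proposition2p2 (R : realType) (d : measure_display)
    (Omega : measurableType d) (P : probability Omega R)
    (mu : probability (plane R) R) (p : R * R -> R)
    (Z : nat -> {RV P >-> plane R}) (c : R) :
  C1_on_unit_square p ->
  (forall z, @unit_square R z -> 0 < p z) ->
  has_density_on_unit_square mu p ->
  iid_with_law Z mu ->
  c < 0 ->
  (limn_esup (fun n : nat =>
     (n%:R^-1)%:E *
     lne (P [set w | (longest_increasing n (fun i => Z i w : R * R))%:R%:E <=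
                     (2%:E * Jbar p + c%:E) * (Num.sqrt n%:R)%:E])) < 0)%E.
Proof.
move=> [px [py [pc _ _ _]]] p0 dens iidZ c0.
have [J JE] : exists J, Jbar p = J%:E.
  by exists (fine (Jbar p)); rewrite fineK// Jbar_fin_num.
have vJ : ((2 * J + c / 2)%:E < 2%:E * Jbar p)%E.
  by rewrite JE -EFinM lte_fin; lra.
have [ka [C [N [ka0 C0 h]]]] := likely_chain_below_Jbar pc p0 dens iidZ vJ.
apply: (@limn_esup_lne_lt0 R _ C ka N.+1) => // n nN.
have [G [mG pG cG]] := h n (ltnW nN).
have n0 : 0 < n%:R :> R by rewrite ltr0n; exact: leq_ltn_trans nN.
apply: lee_wpmul2l; first by rewrite lee_fin invr_ge0 ltW.
set E := [set w | _].
have mE : measurable E.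
  exact: (@measurable_longest_increasing _ _ _ _ Z n (fun l : nat =>
    (l%:R%:E <= (2%:E * Jbar p + c%:E) * (Num.sqrt n%:R)%:E)%E)).
have i1 : P E \in `[0%E, +oo%E] by rewrite in_itv /= leey andbT.
have i2 : (C * expR (- (ka * n%:R)))%:E \in `[0%E, +oo%E].
  by rewrite in_itv /= leey andbT lee_fin mulr_ge0 ?expR_ge0// ltW.
rewrite (lee_lne i1 i2) (prE P mE) lee_fin; apply: le_trans pG; apply: le_pr => // w Ew.
apply: contrapT => nG; move: Ew; rewrite /E /= JE -?EFinM -?EFinD -?EFinM lee_fin.
have hl := chain_longest (cG w nG).
have sn : 0 < Num.sqrt n%:R :> R by rewrite sqrtr_gt0.
have := le_trans hl => /[apply].
rewrite ler_pM2r//; lra.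
Qed.
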